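(* Let $f_*$ be the optimal value of problem $(\mathcal{P})$ and suppose that: (1) $f$, $F$, and $g_i$, $i\in M$, are twice continuously Fréchet differentiable on $\Omega$, $\phi$ is continuously differentiable on its effective domain, and $\phi'(0)>0$; (2) the function $(x,\lambda,\mu)\mapsto\mathcal{L}(x,\lambda,\mu,c)$ is weakly sequentially lower semicontinuous for all $c>0$; (3) the set $\Omega_r(f_*+\varepsilon)=\{x\in\Omega\mid f(x)+r(\|F(x)\|^2+|\max\{g(x),0\}|^2)\le f_*+\varepsilon\}$ is bounded for some $r>0$ and $\varepsilon>0$; (4) the functions $f$, $g_i$, $i\in M$, and $F$, as well as their first and second order Fréchet derivatives, are bounded on $\Omega_r(f_*+\varepsilon)$; (5) there exists $a>0$ such that for all $x\in\Omega_r(f_*+\varepsilon)$ one has $Q(x)[\lambda,\mu]\ge a(\|\lambda\|^2+|\mu|^2)$ for all $\lambda\in H$, $\mu\in\mathbb{R}^m$. Then the augmented Lagrangian $\mathcal{L}(x,\lambda,\mu,c)$ is globally exact.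
   Context: Setting. $X$ and $H$ are real Hilbert spaces, $M=\{1,\dots,m\}$, and $f,g_i\colon X\to\mathbb{R}$ ($i\in M$), $F\colon X\to H$ are continuously Fréchet differentiable; $g=(g_1,\dots,g_m)$. Problem $(\mathcal{P})$: minimise $f(x)$ subject to $F(x)=0$, $g_i(x)\le 0$, $i\in M$. It is assumed that $(\mathcal{P})$ has a globally optimal solution. $|\cdot|$ is the Euclidean norm; $\max\{y,z\}$ of vectors is taken coordinatewise; $\nabla g(x)y\in\mathbb{R}^m$ is the vector with coordinates $\langle\nabla g_i(x),y\rangle$; $DF(x)[\cdot]\colon X\to H$ is the Fréchet derivative, $DF(x)^*$ its adjoint; $\mathrm{diag}(\cdot)$ is the diagonal matrix. Product spaces carry the Hilbert product norm. The function $\phi\colon[0,+\infty)\to[0,+\infty]$ is convex, non-decreasing, lower semicontinuous, $\phi(t)=0$ iff $t=0$, $\mathrm{dom}\,\phi\ne\{0\}$, and either $\mathrm{dom}\,\phi=[0,+\infty)$ and $\phi(t)\to+\infty$ as $t\to\infty$, or $\mathrm{dom}\,\phi=[0,\alpha)$ for some $\alpha>0$ and $\phi(t)\to+\infty$ as $t\to\alpha$. The function $\psi\colon[0,+\infty)^m\to\mathbb{R}$ is continuously differentiable and concave, $\psi(0)>0$, $0$ is a global maximum point of $\psi$, and $\frac{\partial\psi}{\partial y_i}(y)=0$ whenever $y\in[0,+\infty)^m$, $y_i=0$. Put $b(x)=\psi(\max\{g(x),0\})$, $p(x,\mu)=b(x)/(1+|\mu|^2)$, $\Omega=\{x\in X\mid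 b(x)>0,\ \phi(\|F(x)\|^2)<+\infty\}$, $L(x,\lambda,\mu)=f(x)+\langle\lambda,F(x)\rangle+\langle\mu,g(x)\rangle$ for $\lambda\in H$, $\mu\in\mathbb{R}^m$, and $$\eta(x,\lambda,\mu)=\tfrac12\big\|DF(x)[\nabla_xL(x,\lambda,\mu)]\big\|^2+\tfrac12\sum_{i=1}^m\big(\langle\nabla g_i(x),\nabla_xL(x,\lambda,\mu)\rangle+g_i(x)^2\mu_i\big)^2.$$ For $c>0$ the augmented Lagrangian is $$\mathcal{L}(x,\lambda,\mu,c)=f(x)+\langle\lambda,F(x)\rangle+\tfrac c2(1+\|\lambda\|^2)\phi(\|F(x)\|^2)+\langle\mu,q\rangle+\tfrac{c}{2p(x,\mu)}|q|^2+\eta(x,\lambda,\mu),\quad q=\max\{g(x),-\tfrac1c p(x,\mu)\mu\},$$ if $x\in\Omega$, and $\mathcal{L}(x,\lambda,\mu,c)=+\infty$ otherwise. Also $$Q(x)[\lambda,\mu]=\tfrac12\Big\|DF(x)\Big[DF(x)^*[\lambda]+\sum_{i=1}^m\mu_i\nabla g_i(x)\Big]\Big\|^2+\tfrac12\Big|\nabla g(x)\Big(DF(x)^*[\lambda]+\sum_{i=1}^m\mu_i\nabla g_i(x)\Big)+\mathrm{diag}(g_i(x)^2)\mu\Big|^2.$$ A triplet $(x_*,\lambda_*,\mu_* )\in X\times H\times\mathbb{R}^m$ is a KKT-point of $(\mathcal{P})$ if $\nabla_xL(x_*,\lambda_*,\mu_* )=0$, $F(x_* )=0$, $\max\{g(x_*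 ),-\mu_*\}=0$. Standing assumption: for every globally optimal solution $x_*$ of $(\mathcal{P})$ there exist $\lambda_*,\mu_*$ such that $(x_*,\lambda_*,\mu_* )$ is a KKT-point. The augmented Lagrangian is called globally exact if there exists $c_*>0$ such that for all $c\ge c_*$ a triplet $(x_*,\lambda_*,\mu_* )$ is a global minimiser of $\mathcal{L}(\cdot,c)$ over $X\times H\times\mathbb{R}^m$ if and only if $x_*$ is a globally optimal solution of $(\mathcal{P})$ and $(x_*,\lambda_*,\mu_* )$ is a KKT-point of $(\mathcal{P})$. *)

(* Defs.v *)
From mathcomp Require Export all_boot all_order all_algebra.
From mathcomp Require Export all_classical all_reals all_analysis.
From mathcomp Require Export sesquilinear.

Set Implicit Arguments.
Unset Strict Implicit.
Unset Printing Implicit Defensive.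

Import Order.TTheory GRing.Theory Num.Theory.
Import numFieldNormedType.Exports.

Local Open Scope classical_set_scope.
Local Open Scope ring_scope.

(* A real Hilbert space is a completeNormedModType together with a library
   inner product [ip : {dot X for idfun}] inducing its norm. *)
Definition hilbert_dot (R : realType) (X : completeNormedModType R)
    (ip : {dot X for idfun}) : Prop :=
  forall x : X, ip x x = `|x| ^+ 2.

Section Euclidean.
Context {R : realType} {m : nat}.
Implicit Types u v : 'rV[R]_m.

(* The library norm on 'rV[R]_m is the sup norm, hence the explicit
   Euclidean inner product and norm. *)
Definition edot u v : R := \sum_(i < m) u ord0 i * v ord0 i.
Definition enorm u : R := Num.sqrt (edot u u).
Definition vmax u v : 'rV[R]_m := \row_i Num.max (u ord0 i) (v ord0 i).
Definition orthant : set 'rV[R]_m := [set y | forall i, 0 <= y ord0 i].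

End Euclidean.

Section Frechet.
Context {R : realType} {V W : normedModType R}.
Implicit Types (f : V -> W) (A : set V).

(* Continuity of x |-> 'd f x is in operator norm. *)
Definition C1 f : Prop :=
  (forall x, differentiable f x) /\
  (forall (x : V) (e : R), 0 < e ->
     \forall y \near x, forall u, `|'d f y u - 'd f x u| <= e * `|u|).

(* D^2 f(x)[h, u]; this is the second Frechet derivative only under
   [twice_differentiable f x]. *)
Definition diff2 f (x h u : V) : W := 'd (fun y : V => 'd f y u) x h.

(* Frechet differentiability at x of y |-> 'd f y, as a map into the space of
   bounded linear operators with the operator norm. *)
Definition twice_differentiable f (x : V) : Prop :=
  [/\ \forall y \near x, differentiable f y,
      forall u, differentiable (fun y : V => 'd f y u) x,
      exists K : R, forall h u, `|diff2 f x h u| <= K * `|h| * `|u|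
    & forall e : R, 0 < e -> \forall y \near x, forall u,
        `|'d f y u - 'd f x u - diff2 f x (y - x) u| <= e * `|y - x| * `|u| ].

Definition C2_on A f : Prop :=
  (forall x, A x -> twice_differentiable f x) /\
  (forall (x : V) (e : R), A x -> 0 < e -> \forall y \near within A (nbhs x),
     forall h u, `|diff2 f y h u - diff2 f x h u| <= e * `|h| * `|u|).

Definition bounded_C2_on A f : Prop :=
  [/\ exists K : R, forall x, A x -> `|f x| <= K,
      exists K : R, forall x, A x -> forall u, `|'d f x u| <= K * `|u|
    & exists K : R, forall x, A x -> forall h u,
        `|diff2 f x h u| <= K * `|h| * `|u| ].

(* Frechet differentiability relative to A: one-sided at boundary points. *)
Definition has_diff_within A f (x : V) (l : V -> W) : Prop :=
  forall e : R, 0 < e -> \forall y \near within A (nbhs x),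
    `|f y - f x - l (y - x)| <= e * `|y - x|.

End Frechet.

Section HilbertCalculus.
Context {R : realType} {X H : completeNormedModType R}.
Variables (ipX : {dot X for idfun}) (ipH : {dot H for idfun}).

(* The representative exists and is unique, by the Riesz theorem, when the
   derivative (resp. T) is a bounded linear map. *)
Definition grad (f : X -> R) (x : X) : X :=
  xget 0 [set v | forall h, 'd f x h = ipX v h].
Definition adjoint (T : X -> H) (w : H) : X :=
  xget 0 [set v | forall h, ipH (T h) w = ipX h v].

End HilbertCalculus.

Section AdmissibleData.
Context {R : realType} {m : nat}.

(* Only the values on [0, +oo[ matter. *)
Definition edom (phi : R -> \bar R) : set R :=
  [set t | 0 <= t /\ (phi t < +oo)%E].

Record admissible_phi (phi : R -> \bar R) : Prop := AdmissiblePhi {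
  phi_ge0 : forall t : R, 0 <= t -> (0 <= phi t)%E ;
  phi_convex : forall s t a : R, 0 <= s -> 0 <= t -> 0 <= a -> a <= 1 ->
    (phi (a * s + (1 - a) * t)%R <= a%:E * phi s + (1 - a)%R%:E * phi t)%E ;
  phi_nondecreasing : forall s t : R, 0 <= s -> s <= t -> (phi s <= phi t)%E ;
  phi_lsc : forall t a : R, 0 <= t -> (a%:E < phi t)%E ->
    \forall s \near within [set u | 0 <= u] (nbhs t), (a%:E < phi s)%E ;
  phi_eq0 : forall t : R, 0 <= t -> (phi t = 0%E <-> t = 0) ;
  phi_dom : edom phi <> [set 0] ;
  phi_coercive :
    (edom phi = [set t | 0 <= t] /\ phi t @[t --> +oo] --> +oo%E) \/
    (exists2 alpha : R, 0 < alpha &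
       edom phi = [set t | 0 <= t < alpha] /\
       phi t @[t --> alpha^'-] --> +oo%E) }.

(* Continuous differentiability on the effective domain, phi'(0) being the
   right derivative, together with phi'(0) > 0. *)
Definition phi_C1 (phi : R -> \bar R) : Prop :=
  exists dphi : R -> R,
    [/\ forall t, edom phi t ->
          has_diff_within (edom phi) (fun s => fine (phi s) : R) t
            (fun h => dphi t * h),
        {within edom phi, continuous dphi}
      & 0 < dphi 0 ].

(* Only the values on the orthant matter. *)
Record admissible_psi (psi : 'rV[R]_m -> R) : Prop := AdmissiblePsi {
  psi_C1 : exists dpsi : 'rV[R]_m -> 'rV[R]_m,
    (forall y, orthant y -> has_diff_within orthant psi y (edot (dpsi y))) /\
    {within orthant, continuous dpsi} ;
  psi_concave : forall y z (a : R), orthant y -> orthant z -> 0 <= a -> a <= 1 ->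
    a * psi y + (1 - a) * psi z <= psi (a *: y + (1 - a) *: z) ;
  psi0_gt0 : 0 < psi 0 ;
  psi_max0 : forall y, orthant y -> psi y <= psi 0 ;
  (* at y_i = 0 the partial derivative is a one-sided one *)
  psi_partial0 : forall y i, orthant y -> y ord0 i = 0 ->
    (psi (y + t *: delta_mx ord0 i) - psi y) / t @[t --> 0^'+] --> (0 : R) }.

End AdmissibleData.

Section Problem.
Context {R : realType} {X H : completeNormedModType R} {m : nat}.
Variables (ipX : {dot X for idfun}) (ipH : {dot H for idfun}).
Variables (f : X -> R) (F : X -> H) (g : 'I_m -> X -> R).
Variables (phi : R -> \bar R) (psi : 'rV[R]_m -> R).
Implicit Types (x : X) (lam : H) (mu : 'rV[R]_m).

Definition gvec x : 'rV[R]_m := \row_i g i x.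
Definition nabla_g x (y : X) : 'rV[R]_m := \row_i ipX (grad ipX (g i) x) y.

Definition feasible : set X := [set x | F x = 0 /\ forall i, g i x <= 0].
Definition globally_optimal x : Prop :=
  feasible x /\ forall y, feasible y -> f x <= f y.
Definition optimal_value : R := inf [set f x | x in feasible].

Definition lagrangian x lam mu : R :=
  f x + ipH lam (F x) + edot mu (gvec x).
Definition grad_lagrangian x lam mu : X :=
  grad ipX (fun y => lagrangian y lam mu) x.

Definition KKT_point x lam mu : Prop :=
  [/\ grad_lagrangian x lam mu = 0, F x = 0 & vmax (gvec x) (- mu) = 0].

Definition bfun x : R := psi (vmax (gvec x) 0).
Definition pfun x mu : R := bfun x / (1 + enorm mu ^+ 2).
Definition Omega : set X :=
  [set x | 0 < bfun x /\ (phi (`|F x| ^+ 2)%R < +oo)%E].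

Definition eta x lam mu : R :=
  2^-1 * `|'d F x (grad_lagrangian x lam mu)| ^+ 2 +
  2^-1 * \sum_(i < m)
    (ipX (grad ipX (g i) x) (grad_lagrangian x lam mu)
     + g i x ^+ 2 * mu ord0 i) ^+ 2.

Definition qvec x mu (c : R) : 'rV[R]_m :=
  vmax (gvec x) (- (c^-1 * pfun x mu) *: mu).

Definition aug_lagrangian x lam mu (c : R) : \bar R :=
  if x \in Omega then
    ((f x + ipH lam (F x))%R%:E
     + (c / 2 * (1 + `|lam| ^+ 2))%R%:E * phi (`|F x| ^+ 2)%R
     + (edot mu (qvec x mu c)
        + c / (2 * pfun x mu) * enorm (qvec x mu c) ^+ 2
        + eta x lam mu)%R%:E)%E
  else +oo%E.

Definition Qform x lam mu : R :=
  let v := adjoint ipX ipH ('d F x) lam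
           + \sum_(i < m) mu ord0 i *: grad ipX (g i) x in
  2^-1 * `|'d F x v| ^+ 2 +
  2^-1 * enorm (nabla_g x v
                + mu *m diag_mx (\row_i (g i x ^+ 2))) ^+ 2.

Definition Omega_r (r lev : R) : set X :=
  [set x | Omega x /\
     f x + r * (`|F x| ^+ 2 + enorm (vmax (gvec x) 0) ^+ 2) <= lev].

(* Inner product of the Hilbert product X x H x R^m. *)
Definition prod_dot (z w : X * H * 'rV[R]_m) : R :=
  ipX z.1.1 w.1.1 + ipH z.1.2 w.1.2 + edot z.2 w.2.

Definition weak_cvg (u : nat -> X * H * 'rV[R]_m) (z : X * H * 'rV[R]_m) :=
  forall w, prod_dot (u n) w @[n --> \oo] --> prod_dot z w.

Definition weakly_seq_lsc (E : X * H * 'rV[R]_m -> \bar R) : Prop :=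
  forall u z, weak_cvg u z -> (E z <= limn_einf (E \o u))%E.

Definition global_minimiser (c : R) x lam mu : Prop :=
  forall y lam' mu',
    (aug_lagrangian x lam mu c <= aug_lagrangian y lam' mu' c)%E.

Definition globally_exact : Prop :=
  exists2 c0 : R, 0 < c0 & forall c : R, c0 <= c -> forall x lam mu,
    global_minimiser c x lam mu <->
    globally_optimal x /\ KKT_point x lam mu.

End Problem.

(* Main.v *)
(* Write S for the vector whose half squared norm is eta, and
   kkt_op = A A* + diag(0, g^2), so that Q is half the squared norm of kkt_op.

   For large c, the value of the augmented Lagrangian dominates
   f + c kappa (|F|^2 + |q|^2) + eta - C / c. Hence its sublevel sets at f_* lie
   over Omega_r and have bounded multipliers (Q is coercive), uniformly in c, and
   |F|^2 + |q|^2 = O(1/c); weak compactness and weak lower semicontinuity give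
   global minimisers.

   At a global minimiser, stationarity in (lambda, mu) reads kkt_op S = - R with
   |R| = O(sqrt c |(F, q)|), so S is of that order too. Stationarity in x says that
   v = grad_x L(x, (lambda, mu) + w) is O(sqrt c |(F, q)|), where w, proportional to
   (F, q) componentwise, has norm at least const * c |(F, q)|. Since
   kkt_op w = A v - S + (terms of the same order), coercivity of kkt_op gives
   c |(F, q)| <= const * sqrt c |(F, q)|, hence F = 0 and q = 0 for c large, and the
   KKT conditions follow. A minimiser being a KKT point, the minimal value is f_*. *)

From HB Require Import structures.
Require Import Defs.
From mathcomp Require Import ring lra.
Import Order.TTheory GRing.Theory Num.Theory.
Import numFieldNormedType.Exports.
Set Implicit Arguments.
Unset Strict Implicit.
Unset Printing Implicit Defensive.
Local Open Scope classical_set_scope.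
Local Open Scope ring_scope.

(** Because of the max in [b] and [q], [aug_lagrangian] is never differentiated in x. At a
    minimiser, upper expansions L(y) - L(x) <= <v, y - x> + (rho + e) |y - x| are enough: they force
    |v| <= rho. What is only known to be Lipschitz at x goes into rho; the variation of the weight
    [b] costs a multiple of c |q|^2, that of eta a multiple of |S|. The scale sqrt c comes from the
    energy bound c n^2 = O(1), where n = |(F, q)|. For N = sqrt c n, which is bounded, c n^2 and c
    n^3 are both O(N), while the shift of the multipliers has norm at least const * sqrt c N. A
    large c therefore forces N = 0, provided that no constant depends on c; this is why all
    estimates are uniform on [Omega_r]. The factors 1 + |lambda|^2 and 1 / p, where 1 / p grows like
    |mu|^2, serve the lower bound: they absorb the indefinite pairings <lambda, F> and <mu, q>
    before the multipliers are known to be bounded. *)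

Lemma ler_sum_mem (R : realDomainType) (s : seq R) t :
  all (fun x => 0 <= x) s -> t \in s -> t <= \sum_(x <- s) x.
Proof.
elim: s => // x s IH /= /andP[x0 s0]; rewrite inE big_cons => /orP[/eqP ->|ts].
  rewrite lerDl big_seq sumr_ge0 // => y; exact: (allP s0).
by apply: (le_trans (IH s0 ts)); rewrite lerDr.
Qed.

(** * Hilbert forms and weak compactness *)

(* The norm of V is only equivalent to that of the form d: this admits the
   Euclidean form on 'rV_m (sup norm) and the Hilbert sum of two forms (the
   library norm of a product is the max). *)
Record hilbert_form (R : realType) (V : normedModType R) (d : V -> V -> R) : Prop :=
  HilbertForm {
  hf_linear : forall a u v w, d (a *: u + v) w = a * d u w + d v w ;
  hf_sym : forall u v, d u v = d v u ;
  hf_lower : exists2 k : R, 0 < k & forall u, k * `|u| ^+ 2 <= d u u ;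
  hf_upper : exists2 K : R, 0 < K & forall u, d u u <= K * `|u| ^+ 2 ;
  hf_complete : forall u : nat -> V,
    (forall e, 0 < e -> exists N, forall n p,
       (N <= n)%N -> (N <= p)%N -> `|u n - u p| < e) ->
    exists v : V, u n @[n --> \oo] --> v }.

Lemma quadratic_ge0_discr (R : realFieldType) (a b e : R) :
  0 <= a -> (forall t, 0 <= e + 2 * b * t + a * t ^+ 2) -> b ^+ 2 <= a * e.
Proof.
move=> a0 H; have [a_gt0|] := ltrP 0 a.
  have := H (- b / a).
  have -> : e + 2 * b * (- b / a) + a * (- b / a) ^+ 2 = e - b ^+ 2 / a.
    by field; rewrite gt_eqF.
  by rewrite subr_ge0 ler_pdivrMr // mulrC.
move=> ale; have a_eq0 : a = 0 by apply/eqP; rewrite eq_le ale a0.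
move: H; rewrite a_eq0 => H; rewrite mul0r.
have [->|bn0] := eqVneq b 0; first by rewrite expr0n.
(* For a = 0 the affine function e + 2 b t takes the value -1 at this point. *)
have := H (- (e + 1) / (2 * b)); rewrite mul0r addr0 mulrC divfK ?mulf_neq0 ?pnatr_eq0 //.
lra.
Qed.

(** First-order condition at t = 0 along a line. It is applied to quadratic majorants in the
    multiplier variables. *)
Lemma linear_quadratic_ge0 (R : realFieldType) (b a : R) :
  (forall t, 0 <= b * t + a * t ^+ 2) -> b = 0.
Proof.
move=> H; suff : b ^+ 2 <= 0 by rewrite le_eqVlt ltNge sqr_ge0 orbF sqrf_eq0 => /eqP.
have a0 : 0 <= a by have := H 1; have := H (-1); rewrite sqrrN expr1n; lra.
have := @quadratic_ge0_discr _ a (b / 2) 0 a0.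
rewrite mulr0 expr_div_n pmulr_lle0 ?invr_gt0 ?exprn_gt0 //; apply => t.
by rewrite add0r (_ : 2 * (b / 2) = b) //; field.
Qed.

Definition fnorm (R : realType) (V : normedModType R) (d : V -> V -> R) (u : V) : R :=
  Num.sqrt (d u u).

Section HilbertForm.
Context {R : realType} {V : normedModType R} {d : V -> V -> R}.
Hypothesis hd : hilbert_form d.
Implicit Types (u v w : V) (a : R).

Lemma hfDl u v w : d (u + v) w = d u w + d v w.
Proof. by have := hf_linear hd 1 u v w; rewrite scale1r mul1r. Qed.
Lemma hf0l w : d 0 w = 0.
Proof. by have := hfDl 0 0 w; rewrite addr0; lra. Qed.
Lemma hfZl a u w : d (a *: u) w = a * d u w.
Proof. by have := hf_linear hd a u 0 w; rewrite addr0 hf0l addr0. Qed.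
Lemma hfNl u w : d (- u) w = - d u w.
Proof. by rewrite -scaleN1r hfZl mulN1r. Qed.
Lemma hfBl u v w : d (u - v) w = d u w - d v w.
Proof. by rewrite hfDl hfNl. Qed.
Lemma hfDr u v w : d w (u + v) = d w u + d w v.
Proof. by rewrite !(hf_sym hd w) hfDl. Qed.
Lemma hf0r w : d w 0 = 0.
Proof. by rewrite (hf_sym hd) hf0l. Qed.
Lemma hfZr a u w : d w (a *: u) = a * d w u.
Proof. by rewrite !(hf_sym hd w) hfZl. Qed.
Lemma hfNr u w : d w (- u) = - d w u.
Proof. by rewrite !(hf_sym hd w) hfNl. Qed.
Lemma hfBr u v w : d w (u - v) = d w u - d w v.
Proof. by rewrite hfDr hfNr. Qed.
Lemma hf_suml I r (P : pred I) (E : I -> V) w :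
  d (\sum_(i <- r | P i) E i) w = \sum_(i <- r | P i) d (E i) w.
Proof. by apply: (big_morph (d^~ w)) => [u v|]; rewrite ?hfDl ?hf0l. Qed.

Lemma hf_ge0 u : 0 <= d u u.
Proof.
by have [k k0 /(_ u)] := hf_lower hd; apply: le_trans; rewrite (mulr_ge0 (ltW k0)) // exprn_ge0.
Qed.

Lemma hf_eq0 u : d u u = 0 -> u = 0.
Proof.
move=> du; have [k k0 /(_ u)] := hf_lower hd.
rewrite du pmulr_rle0 // => h; apply/eqP; rewrite -normr_eq0 -sqrf_eq0.
by rewrite eq_le h sqr_ge0.
Qed.

Lemma hf_eq0r u : (forall v, d u v = 0) -> u = 0.
Proof. by move=> h; apply: hf_eq0. Qed.

Lemma fnorm_ge0 u : 0 <= fnorm d u. Proof. exact: sqrtr_ge0. Qed.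
Lemma sqr_fnorm u : fnorm d u ^+ 2 = d u u. Proof. by rewrite sqr_sqrtr // hf_ge0. Qed.
Lemma fnorm_eq0 u : fnorm d u = 0 -> u = 0.
Proof. by move=> du; apply: hf_eq0; rewrite -sqr_fnorm du expr0n. Qed.

Lemma hf_CS2 u v : d u v ^+ 2 <= d u u * d v v.
Proof.
rewrite mulrC; apply: quadratic_ge0_discr => [|t]; first exact: hf_ge0.
have := hf_ge0 (u + t *: v).
by rewrite !(hfDl, hfDr, hfZl, hfZr) (hf_sym hd v u); congr (0 <= _); ring.
Qed.

Lemma hf_CS u v : `|d u v| <= fnorm d u * fnorm d v.
Proof.
rewrite -[leLHS]sqrtr_sqr /fnorm -sqrtrM ?hf_ge0 //; apply: ler_wsqrtr; exact: hf_CS2.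
Qed.

Lemma hf_leCS u v : d u v <= fnorm d u * fnorm d v.
Proof. exact: le_trans (ler_norm _) (hf_CS u v). Qed.

Lemma fnormZ a u : fnorm d (a *: u) = `|a| * fnorm d u.
Proof. by rewrite /fnorm hfZl hfZr mulrA -expr2 sqrtrM ?sqr_ge0 // sqrtr_sqr. Qed.

Lemma fnormN u : fnorm d (- u) = fnorm d u.
Proof. by rewrite -scaleN1r fnormZ normrN1 mul1r. Qed.

Lemma fnormD u v : fnorm d (u + v) <= fnorm d u + fnorm d v.
Proof.
rewrite -(@ler_pXn2r _ 2) ?nnegrE ?addr_ge0 ?fnorm_ge0 //.
rewrite sqr_fnorm !(hfDl, hfDr) (hf_sym hd v u) sqrrD !sqr_fnorm.
have := hf_leCS u v; lra.
Qed.

Lemma fnormB u v : fnorm d (u - v) <= fnorm d u + fnorm d v.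
Proof. by rewrite -(fnormN v) fnormD. Qed.

Lemma fnorm_le_norm : exists2 K : R, 0 < K & forall u, fnorm d u <= K * `|u|.
Proof.
have [K K0 h] := hf_upper hd; exists (Num.sqrt K); first by rewrite sqrtr_gt0.
move=> u; rewrite -(@ler_pXn2r _ 2) ?nnegrE ?mulr_ge0 ?sqrtr_ge0 ?normr_ge0 //.
by rewrite sqr_fnorm exprMn (sqr_sqrtr (ltW K0)).
Qed.

Lemma hf_continuousl w : continuous (d^~ w).
Proof.
have [K K0 h] := fnorm_le_norm.
move=> u; apply/cvgrPdist_le => e e0.
have C0 : 0 < K * fnorm d w + 1 by rewrite ltr_wpDl // mulr_ge0 ?fnorm_ge0 ?ltW.
near=> v; rewrite -hfBl.
apply: (le_trans (hf_CS _ _)).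
apply: (@le_trans _ _ ((K * fnorm d w + 1) * `|u - v|)).
  rewrite mulrDl mul1r mulrAC; apply: (@le_trans _ _ (K * `|u - v| * fnorm d w)).
    by rewrite ler_wpM2r ?fnorm_ge0.
  by rewrite lerDl.
rewrite -ler_pdivlMl //; near: v; apply: cvgr_dist_le => //.
by rewrite mulr_gt0 // invr_gt0.
Unshelve. all: by end_near. Qed.

(* The minimising sequences of d v v - 2 l v on W are Cauchy by the
   parallelogram identity. *)
Lemma riesz_subspace (W : set V) (l : V -> R) (B : R) :
  W 0 -> (forall a u v, W u -> W v -> W (a *: u + v)) -> closed W ->
  (forall a u v, l (a *: u + v) = a * l u + l v) ->
  (forall u, `|l u| <= B * `|u|) ->
  exists2 p, W p & forall w, W w -> l w = d p w.
Proof.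
move=> W0 WL Wc lL lB.
have lD u v : l (u + v) = l u + l v by have := lL 1 u v; rewrite scale1r mul1r.
have l0 : l 0 = 0 by have := lD 0 0; rewrite addr0; lra.
have lZ a u : l (a *: u) = a * l u by have := lL a u 0; rewrite !addr0 l0 addr0.
have WZ a u : W u -> W (a *: u) by move=> Wu; have := WL a u 0 Wu W0; rewrite addr0.
have WD u v : W u -> W v -> W (u + v) by move=> Wu Wv; rewrite -(scale1r u); exact: WL.
pose J v := d v v - 2 * l v.
have [k k0 hk] := hf_lower hd.
(* Complete the square in [|v|]: J is bounded below although the norm of [V] is only equivalent to
   that of [d]. *)
have Jlow v : - (B ^+ 2 / k) <= J v.
  have hl : l v <= B * `|v| by exact: le_trans (ler_norm _) (lB v).
  have := hk v; rewrite /J => hkv.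
  have : 0 <= k * (`|v| - B / k) ^+ 2 by rewrite mulr_ge0 ?sqr_ge0 // ltW.
  have -> : k * (`|v| - B / k) ^+ 2 = k * `|v| ^+ 2 - 2 * (B * `|v|) + B ^+ 2 / k.
    by field; rewrite gt_eqF.
  lra.
pose S := [set J v | v in W].
have Sinf : has_inf S.
  by split; [exists (J 0), 0 | exists (- (B ^+ 2 / k)) => _ [v _ <-]].
have Jinf v : W v -> inf S <= J v by move=> Wv; apply: ge_inf; [exact: Sinf.2|exists v].
have pick n : exists v, W v /\ J v < inf S + n.+1%:R^-1.
  have [|_ [v Wv <-] hv] := inf_adherent (eps := n.+1%:R^-1) _ Sinf.
    by rewrite invr_gt0.
  by exists v.
have {pick} [u hu] := choice pick.
(* Almost minimality of [u n] along the line in direction [w] is a nonnegative quadratic in t; its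
   discriminant bounds the defect in the equation to be solved. *)
have key n w : W w -> (d (u n) w - l w) ^+ 2 <= d w w * n.+1%:R^-1.
  move=> Ww; apply: quadratic_ge0_discr => [|t]; first exact: hf_ge0.
  have [Wu Ju] := hu n.
  have := Jinf (u n + t *: w) (WD _ _ Wu (WZ _ _ Ww)).
  have -> : J (u n + t *: w) = J (u n) + 2 * (d (u n) w - l w) * t + d w w * t ^+ 2.
    by rewrite /J !(hfDl, hfDr, hfZl, hfZr, lD, lZ) (hf_sym hd w (u n)); ring.
  by move: Ju; move: (n.+1%:R^-1) => e; lra.
have close n p : d (u n - u p) (u n - u p) <= 2 * (n.+1%:R^-1 + p.+1%:R^-1).
  have [Wn Jn] := hu n; have [Wp Jp] := hu p.
  have := Jinf (2^-1 *: (u n + u p)) (WZ _ _ (WD _ _ Wn Wp)).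
  have -> : J (2^-1 *: (u n + u p)) =
     2^-1 * J (u n) + 2^-1 * J (u p) - 4^-1 * d (u n - u p) (u n - u p).
    rewrite /J !(hfDl, hfDr, hfZl, hfZr, hfNl, hfNr, lD, lZ) (hf_sym hd (u p) (u n)).
    by field.
  by move: Jn Jp; move: (n.+1%:R^-1) (p.+1%:R^-1) => e e'; lra.
have inv_small (e : R) : 0 < e -> exists N, forall n, (N <= n)%N -> n.+1%:R^-1 < e.
  move=> e0; have [N _ hN] := near_infty_natSinv_lt (PosNum e0).
  by exists N => n Nn; exact: hN.
have [p up] : exists p : V, u n @[n --> \oo] --> p.
  apply: (hf_complete hd) => e e0.
  have ke : 0 < k * e ^+ 2 / 4 by rewrite divr_gt0 // mulr_gt0 // exprn_gt0.
  have [N hN] := inv_small _ ke; exists N => n p Nn Np.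
  suff : `|u n - u p| ^+ 2 < e ^+ 2 by rewrite ltr_pXn2r // nnegrE ?normr_ge0 // ltW.
  rewrite -(ltr_pM2l k0); apply: (le_lt_trans (hk _)); apply: (le_lt_trans (close _ _)).
  have := hN _ Nn; have := hN _ Np.
  by move: (n.+1%:R^-1) (p.+1%:R^-1) => x y; lra.
exists p; first by apply: (closed_cvg W Wc _ p up); near=> n; have [] := hu n.
move=> w Ww; apply/eqP; rewrite -subr_eq0 -oppr_eq0 opprB; apply/eqP.
have cv : d (u n) w - l w @[n --> \oo] --> d p w - l w.
  by apply: cvgB; [exact: (cvg_comp _ _ up (@hf_continuousl w p))|exact: cvg_cst].
have sq0 : (d (u n) w - l w) ^+ 2 @[n --> \oo] --> (0 : R).
  apply/cvgrPdist_lt => e e0.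
  have C0 : 0 < d w w + 1 by rewrite ltr_wpDl // hf_ge0.
  have [N hN] := inv_small _ (divr_gt0 e0 C0); exists N => // n /= /hN.
  rewrite sub0r normrN ger0_norm ?sqr_ge0 // ltr_pdivlMr // mulrC mulrDl mul1r => h.
  by apply: (le_lt_trans (key _ _ Ww)); apply: le_lt_trans h; rewrite lerDl invr_ge0.
have : (d p w - l w) ^+ 2 = 0.
  by apply/esym; apply: (cvg_unique _ sq0) => //; rewrite expr2; apply: cvgM.
by move/eqP; rewrite sqrf_eq0 => /eqP.
Unshelve. all: by end_near. Qed.

(* Along a nonprincipal ultrafilter z converges weakly to some p, by Riesz. The
   indices s k make z (s k) - p almost orthogonal to p and to every z i with
   i < k, hence asymptotically orthogonal to the closed span of these vectors.
   As z (s k) - p lies in that span, a test vector may be projected onto it. *)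
Lemma weak_sequential_compactness (z : nat -> V) (B : R) :
  (forall n, `|z n| <= B) ->
  exists p (s : nat -> nat), (forall k, (k <= s k)%N) /\
    forall w, d (z (s k)) w @[k --> \oo] --> d p w.
Proof.
move=> zB.
have [U [UU leU]] := ultraFilterLemma (@eventually_filter).
have [K K0 hK] := fnorm_le_norm.
have dB n w : `|d (z n) w| <= K * B * fnorm d w.
  apply: (le_trans (hf_CS _ _)); rewrite ler_wpM2r ?fnorm_ge0 //.
  by apply: (le_trans (hK _)); rewrite ler_pM2l.
(* The pairings stay in a compact segment, and the image of an ultrafilter is an ultrafilter, hence
   converges there. *)
have limU w : exists l, d (z n) w @[n --> U] --> l /\ `|l| <= K * B * fnorm d w.
  pose b := K * B * fnorm d w.
  have := @segment_compact _ (- b) b; rewrite compact_ultra.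
  have UF : UltraFilter (d (z n) w @[n --> U]).
    split=> [|G GF leG]; first exact: fmap_proper_filter.
    apply/seteqP; split=> // A GA.
    have [//|nA] := in_ultra_setVsetC ((fun n => d (z n) w) @^-1` A) UU.
    by have [x []] := filter_ex (filterI GA (leG (~` A) nA)).
  move=> /(_ (d (z n) w @[n --> U])) [].
    by apply: (@filterE _ U) => n /=; rewrite in_itv /= -ler_norml; exact: dB.
  by move=> l [+ hl]; rewrite /= in_itv /= -ler_norml => lb; exists l.
have {limU} [l hl] := choice limU.
have lL a u v : l (a *: u + v) = a * l u + l v.
  apply: (cvg_unique _ (hl _).1) => //.
  have -> : (fun n => d (z n) (a *: u + v)) = (fun n => a * d (z n) u + d (z n) v).
    by apply/funext => n; rewrite hfDr hfZr.
  by apply: cvgD; [apply: cvgM; [exact: cvg_cst|exact: (hl u).1]|exact: (hl v).1].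
have B0 : 0 <= B by exact: le_trans (normr_ge0 (z 0%N)) (zB _).
have lB u : `|l u| <= K * B * K * `|u|.
  by apply: (le_trans (hl u).2); rewrite -[leRHS]mulrA ler_wpM2l // mulr_ge0 // ltW.
have [p _ hp] := @riesz_subspace setT l _ I (fun _ _ _ _ _ => I) closedT lL lB.
have pU w : d (z n) w @[n --> U] --> d p w by rewrite -hp //; exact: (hl w).1.
have pick k : exists n, (k <= n)%N /\ `|d (z n - p) p| < k.+1%:R^-1 /\
   forall i, (i < k)%N -> `|d (z n - p) (z i)| < k.+1%:R^-1.
  have U1 : \forall n \near U, (k <= n)%N by apply: leU; exists k.
  have U2 w : \forall n \near U, `|d (z n - p) w| < k.+1%:R^-1.
    have /cvgrPdist_lt /(_ k.+1%:R^-1) := pU w; rewrite invr_gt0 ltr0Sn => /(_ isT).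
    by apply: filterS => n; rewrite hfBl distrC.
  have U3 : \forall n \near U, forall i : 'I_k, `|d (z n - p) (z i)| < k.+1%:R^-1.
    by apply: filter_forall => i; exact: U2.
  have [n [kn [h1 h2]]] := filter_ex (filterI U1 (filterI (U2 p) U3)).
  by exists n; split=> //; split=> // i ik; exact: (h2 (Ordinal ik)).
have {pick} [s hs] := choice pick.
exists p, s; split=> [k|]; first by have [] := hs k.
pose W := [set w | d (z (s k) - p) w @[k --> \oo] --> (0 : R)].
have WL a u v : W u -> W v -> W (a *: u + v).
  rewrite /W /= => Wu Wv.
  have -> : (fun k => d (z (s k) - p) (a *: u + v)) =
            (fun k => a * d (z (s k) - p) u + d (z (s k) - p) v).
    by apply/funext => k; rewrite hfDr hfZr.
  by rewrite -[0](mulr0 a) -[a * 0]addr0; apply: cvgD => //; apply: cvgM => //; exact: cvg_cst.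
have inv0 : k.+1%:R^-1 @[k --> \oo] --> (0 : R).
  exact: cvg_harmonic.
have Wp : W p.
  apply/cvgrPdist_lt => e e0; have /cvgrPdist_lt /(_ _ e0) := inv0.
  apply: filterS => k; rewrite !sub0r !normrN => h.
  by apply: (lt_trans (hs k).2.1); apply: le_lt_trans h; exact: ler_norm.
have Wz i : W (z i).
  apply/cvgrPdist_lt => e e0; have /cvgrPdist_lt /(_ _ e0) h0 := inv0.
  near=> k; have : `|0 - k.+1%:R^-1| < e by near: k; exact: h0.
  rewrite !sub0r !normrN => h.
  apply: le_lt_trans h; apply: le_trans (ler_norm _); apply/ltW/(hs k).2.2; near: k.
  exact: nbhs_infty_gt.
have W0 : W 0.
  by rewrite /W /=; under eq_cvg do rewrite hf0r; exact: cvg_cst.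
have xB k : fnorm d (z (s k) - p) <= K * B + fnorm d p.
  by apply: (le_trans (fnormB _ _)); rewrite lerD2r (le_trans (hK _)) // ler_pM2l.
have Wc : closed W.
  move=> w clw; apply/cvgrPdist_lt => e e0.
  pose M := K * B + fnorm d p.
  have M0 : 0 < M * K + 1.
    by rewrite ltr_wpDl // mulr_ge0 ?(ltW K0) // addr_ge0 ?fnorm_ge0 // mulr_ge0 ?(ltW K0).
  have e2 : 0 < e / 2 by rewrite divr_gt0.
  have [v [Wv]] := clw _ (nbhsx_ballx w (e / 2 / (M * K + 1)) (divr_gt0 e2 M0)).
  rewrite -ball_normE /= ltr_pdivlMr // => wv.
  have /cvgrPdist_lt /(_ _ e2) := Wv.
  apply: filterS => k; rewrite !sub0r !normrN => h.
  have -> : w = v + (w - v) by rewrite addrC subrK.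
  rewrite hfDr; apply: (le_lt_trans (ler_normD _ _)).
  have h2 : `|d (z (s k) - p) (w - v)| <= (M * K + 1) * `|w - v|.
    apply: (le_trans (hf_CS _ _)); apply: (@le_trans _ _ (M * (K * `|w - v|))).
      by apply: ler_pM; rewrite ?fnorm_ge0.
    by rewrite mulrA ler_wpM2r // lerDl.
  by move: wv h h2; rewrite mulrC; lra.
move=> w.
have lwB u : `|d u w| <= K * fnorm d w * `|u|.
  by apply: (le_trans (hf_CS _ _)); rewrite mulrAC ler_wpM2r ?fnorm_ge0.
(* [q] is the orthogonal projection of [w] onto [W], obtained by representing the pairing with [w]
   on [W]. *)
have [q Wq hq] := @riesz_subspace W (d^~ w) _ W0 WL Wc
  (fun a u v => hf_linear hd a u v w) lwB.
have Wzp k : W (z (s k) - p).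
  by rewrite addrC -scaleN1r; apply: WL.
have : d (z (s k) - p) w + d p w @[k --> \oo] --> 0 + d p w.
  apply: cvgD; last exact: cvg_cst.
  under eq_cvg => k do rewrite (hq _ (Wzp k)) (hf_sym hd).
  exact: Wq.
by rewrite add0r; under eq_cvg do rewrite -hfDl subrK.
Unshelve. all: by end_near. Qed.
End HilbertForm.

(** * Instances: inner products, the Euclidean form, products *)

Lemma complete_from_cauchy (R : realType) (T : normedModType R) :
  (forall F : set_system T, ProperFilter F -> cauchy F -> cvg F) ->
  forall u : nat -> T,
  (forall e, 0 < e -> exists N, forall n p,
     (N <= n)%N -> (N <= p)%N -> `|u n - u p| < e) ->
  exists v : T, u n @[n --> \oo] --> v.
Proof.
move=> cT u uC.
suff /cT : cauchy (u @ \oo) by move/cvg_ex => -[v uv]; exists v.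
apply: cauchy_exP => e e0; have [N hN] := uC _ e0.
by exists (u N); exists N => // n /= Nn; rewrite -ball_normE /=; exact: hN.
Qed.

Lemma hilbert_form_dot (R : realType) (X : completeNormedModType R)
  (ip : {dot X for idfun}) : hilbert_dot ip -> hilbert_form ip.
Proof.
move=> hip; split.
- by move=> a u v w; rewrite linearDl linearZl_LR.
- by move=> u v; rewrite hermC expr0 mul1r.
- by exists 1 => // u; rewrite mul1r hip.
- by exists 1 => // u; rewrite mul1r hip.
- by apply: complete_from_cauchy => F PF; exact: cauchy_cvg.
Qed.

Lemma fnorm_dot (R : realType) (X : completeNormedModType R)
  (ip : {dot X for idfun}) : hilbert_dot ip -> forall u, fnorm ip u = `|u|.
Proof. by move=> hip u; rewrite /fnorm hip sqrtr_sqr normr_id. Qed.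

Lemma coord_le_norm (R : realType) m (u : 'rV[R]_m) i : `|u ord0 i| <= `|u|.
Proof.
rewrite /Num.norm /= mx_normrE; have := @le_bigmax _ _ _ 0 (fun i : 'I_1 * 'I_m => `|u i.1 i.2|) (ord0, i).
exact.
Qed.

Lemma norm_le_coord (R : realType) m (u : 'rV[R]_m) (K : R) :
  0 <= K -> (forall i, `|u ord0 i| <= K) -> `|u| <= K.
Proof.
move=> K0 h; rewrite /Num.norm /= mx_normrE; apply: bigmax_le => // -[i j] _ /=.
by rewrite (ord1 i).
Qed.

Lemma hilbert_form_edot (R : realType) m : hilbert_form (@edot R m).
Proof.
split.
- move=> a u v w; rewrite /edot mulr_sumr -big_split /=; apply: eq_bigr => i _.
  by rewrite !mxE; ring.
- by move=> u v; apply: eq_bigr => i _; rewrite mulrC.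
- exists 1 => // u; rewrite mul1r.
  have e0 : 0 <= edot u u by apply: sumr_ge0 => i _; rewrite -expr2 sqr_ge0.
  have : `|u| <= Num.sqrt (edot u u).
    apply: norm_le_coord => [|i]; first exact: sqrtr_ge0.
    rewrite -sqrtr_sqr; apply: ler_wsqrtr; rewrite /edot (bigD1 i) //= -expr2 lerDl.
    by apply: sumr_ge0 => j _; rewrite -expr2 sqr_ge0.
  by rewrite -(@ler_pXn2r _ 2) ?nnegrE ?sqrtr_ge0 // sqr_sqrtr.
(* The added 1 keeps the constant positive when m = 0. *)
- exists (m%:R + 1); first by rewrite ltr_wpDl.
  move=> u; apply: (@le_trans _ _ (m%:R * `|u| ^+ 2)); last by rewrite ler_wpM2r ?exprn_ge0 ?lerDl.
  have -> : m%:R * `|u| ^+ 2 = \sum_(i < m) `|u| ^+ 2.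
    by rewrite sumr_const card_ord mulr_natl.
  apply: ler_sum => i _.
  by rewrite -expr2 -real_normK ?num_real // lerXn2r ?nnegrE // coord_le_norm.
- by apply: complete_from_cauchy => F PF; exact: cauchy_cvg.
Qed.

Lemma sqr_enorm (R : realType) m (u : 'rV[R]_m) : enorm u ^+ 2 = edot u u.
Proof. exact: (sqr_fnorm (hilbert_form_edot R m) u). Qed.

Lemma le_enorm (R : realType) m (u : 'rV[R]_m) i : `|u ord0 i| <= enorm u.
Proof.
rewrite -sqrtr_sqr; apply: ler_wsqrtr; rewrite /edot (bigD1 i) //= -expr2 lerDl.
by apply: sumr_ge0 => j _; rewrite -expr2 sqr_ge0.
Qed.

Lemma enorm_le_sum (R : realType) m (u : 'rV[R]_m) : enorm u <= \sum_i `|u ord0 i|.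
Proof.
have s0 : 0 <= \sum_i `|u ord0 i| by apply: sumr_ge0.
rewrite -(@ler_pXn2r _ 2) ?nnegrE ?sqrtr_ge0 //.
rewrite (sqr_fnorm (hilbert_form_edot R m)) /edot expr2 mulr_suml; apply: ler_sum => i _.
rewrite -expr2 -real_normK ?num_real // expr2 ler_wpM2l //.
by rewrite (bigD1 i) //= lerDl sumr_ge0.
Qed.

Lemma hilbert_form_prod (R : realType) (V W : normedModType R)
    (d : V -> V -> R) (e : W -> W -> R) :
  hilbert_form d -> hilbert_form e ->
  hilbert_form (fun z w : V * W => d z.1 w.1 + e z.2 w.2).
Proof.
move=> hd he; split.
- by move=> a [u u'] [v v'] [w w'] /=; rewrite (hf_linear hd) (hf_linear he); ring.
- by move=> u v; rewrite (hf_sym hd) (hf_sym he).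
- have [k k0 hk] := hf_lower hd; have [l l0 hl] := hf_lower he.
  exists (Num.min k l); first by rewrite lt_min k0.
  move=> [u v]; rewrite prod_normE /=.
  have m1 : Num.min k l <= k by rewrite ge_min lexx.
  have m2 : Num.min k l <= l by rewrite ge_min lexx orbT.
  have [uv|vu] := leP `|u| `|v|.
    rewrite -[leLHS]add0r; apply: lerD; first exact: hf_ge0.
    by apply: le_trans (hl v); rewrite ler_wpM2r ?exprn_ge0.
  rewrite -[leLHS]addr0; apply: lerD; last exact: hf_ge0.
  by apply: le_trans (hk u); rewrite ler_wpM2r ?exprn_ge0.
- have [k k0 hk] := hf_upper hd; have [l l0 hl] := hf_upper he.
  exists (k + l); first exact: addr_gt0.
  move=> [u v]; rewrite prod_normE /= mulrDl; apply: lerD.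
    apply: (le_trans (hk u)); rewrite ler_pM2l // lerXn2r ?nnegrE ?le_max ?lexx ?normr_ge0 //.
  apply: (le_trans (hl v)); rewrite ler_pM2l // lerXn2r ?nnegrE ?le_max ?lexx ?normr_ge0 ?orbT //.
- move=> u uC.
  have [v1 h1] : exists v : V, (u n).1 @[n --> \oo] --> v.
    apply: (hf_complete hd) => eps /uC [N hN]; exists N => n p Nn Np.
    by have := hN _ _ Nn Np; rewrite prod_normE /= gt_max => /andP[].
  have [v2 h2] : exists v : W, (u n).2 @[n --> \oo] --> v.
    apply: (hf_complete he) => eps /uC [N hN]; exists N => n p Nn Np.
    by have := hN _ _ Nn Np; rewrite prod_normE /= gt_max => /andP[].
  exists (v1, v2).
  have -> : u = (fun n => ((u n).1, (u n).2)) by apply/funext => n; case: (u n).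
  exact: cvg_pair.
Qed.

Lemma riesz (R : realType) (V : normedModType R) (d : V -> V -> R)
    (l : V -> R) (B : R) : hilbert_form d ->
  (forall a u v, l (a *: u + v) = a * l u + l v) ->
  (forall u, `|l u| <= B * `|u|) -> exists p, forall w, l w = d p w.
Proof.
move=> hd lL lB.
have [p _ hp] := @riesz_subspace _ _ _ hd setT l B I (fun _ _ _ _ _ => I) closedT lL lB.
by exists p => w; exact: hp.
Qed.

(** * Gradients and local expansions *)

Section Duality.
Context {R : realType} {X H : completeNormedModType R}.
Variables (ipX : {dot X for idfun}) (ipH : {dot H for idfun}).
Hypotheses (hX : hilbert_dot ipX) (hH : hilbert_dot ipH).

Lemma diff_bounded (W : normedModType R) (f : X -> W) x : differentiable f x ->
  exists2 K, 0 < K & forall h, `|'d f x h| <= K * `|h|.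
Proof. by move=> df; apply: linear_lipschitz; exact: diff_continuous. Qed.

(** Differentiability makes the derivative a bounded functional, so the Riesz representative exists
    and [xget] does not fall back on its default value. *)
Lemma gradE (f : X -> R) x h : differentiable f x -> ipX (grad ipX f x) h = 'd f x h.
Proof.
move=> df; have [K _ hK] := diff_bounded df.
have [p hp] := riesz (hilbert_form_dot hX)
  (fun a u v => linearP ('d f x : {linear X -> R^o}) a u v) hK.
by apply/esym; rewrite /grad; case: xgetP => [v _ hv|/(_ p)].
Qed.

Lemma adjointE (F : X -> H) x h w : differentiable F x ->
  ipH ('d F x h) w = ipX h (adjoint ipX ipH ('d F x) w).
Proof.
move=> dF; have [K K0 hK] := diff_bounded dF.
have hfX := hilbert_form_dot hX; have hfH := hilbert_form_dot hH.
have lin a u v : ipH ('d F x (a *: u + v)) w = a * ipH ('d F x u) w + ipH ('d F x v) w.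
  by rewrite linearP (hf_linear hfH).
have bnd u : `|ipH ('d F x u) w| <= K * `|w| * `|u|.
  apply: (le_trans (hf_CS hfH _ _)); rewrite !(fnorm_dot hH) mulrAC.
  by rewrite ler_wpM2r.
have [p hp] := riesz hfX lin bnd.
rewrite /adjoint; case: xgetP => [v _ hv|/(_ p) []]; first exact: hv.
by move=> u; rewrite hp (hf_sym hfX).
Qed.

Lemma is_diff_hf (f : X -> H) (x : X) w : differentiable f x ->
  is_diff x (fun y => ipH w (f y)) (fun h => ipH w ('d f x h)).
Proof.
move=> df; have hfH := hilbert_form_dot hH.
have lin : linear_for *%R (ipH w).
  by move=> a u v; rewrite hfDr // hfZr.
pose l : {linear H -> R^o} := HB.pack (ipH w : H -> R^o) (GRing.isLinear.Build R H R^o *:%R (ipH w : H -> R^o) lin).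
have lc : continuous l.
  move=> u; have := @hf_continuousl _ _ _ hfH w u.
  by rewrite (_ : (fun v => ipH v w) = l) //; apply/funext => v; rewrite /= (hf_sym hfH).
have dl : differentiable l (f x) by exact: linear_differentiable.
have dc : differentiable (l \o f) x by apply: differentiable_comp.
apply: DiffDef => //.
by rewrite -[LHS]/('d (l \o f) x : X -> R^o) diff_comp // diff_lin.
Qed.
End Duality.

Section LocalExpansion.
Context {R : realType} {V W : normedModType R}.
Variables (f : V -> W) (x : V).

Lemma diff_expansion : differentiable f x ->
  forall e : R, 0 < e -> \forall y \near x,
    `|f y - f x - 'd f x (y - x)| <= e * `|y - x|.
Proof.
move=> df e e0.
have dE := diffE df; rewrite lim_id // in dE.
near=> y.
have E (a b o : W) : a + b + o - a - b = o by rewrite -addrA -opprD addrC addKr.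
rewrite [f y]dE E; near: y.
by apply: littleoP.
Unshelve. all: by end_near. Qed.

Lemma diff_lipschitz (K : R) : differentiable f x ->
  (forall h, `|'d f x h| <= K * `|h|) ->
  \forall y \near x, `|f y - f x| <= (K + 1) * `|y - x|.
Proof.
move=> df hK; near=> y.
rewrite -[_ - _](subrK ('d f x (y - x))) mulrDl mul1r addrC.
apply: (le_trans (ler_normD _ _)); apply: lerD => //.
by rewrite -[leRHS]mul1r; near: y; exact: diff_expansion.
Unshelve. all: by end_near. Qed.

(** The later estimates see second derivatives only through this bound, whose constant depends on
    [K] alone. *)
Lemma twice_diff_lipschitz (K : R) : twice_differentiable f x ->
  (forall h u, `|diff2 f x h u| <= K * `|h| * `|u|) ->
  \forall y \near x, forall u, `|'d f y u - 'd f x u| <= (K + 1) * `|y - x| * `|u|.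
Proof.
move=> [_ _ _ tw] hK; near=> y => u.
rewrite -[_ - _](subrK (diff2 f x (y - x) u)) mulrDl mul1r mulrDl addrC.
apply: (le_trans (ler_normD _ _)); apply: lerD => //.
rewrite -[`|y - x|]mul1r; move: u; near: y; exact: tw.
Unshelve. all: by end_near. Qed.
End LocalExpansion.

Lemma is_diff_sum (R : realType) (V W : normedModType R) (I : Type) (s : seq I)
  (h dh : I -> V -> W) x : (forall i, is_diff x (h i) (dh i)) ->
  is_diff x (fun y => \sum_(i <- s) h i y) (fun v => \sum_(i <- s) dh i v).
Proof.
move=> hh; elim: s => [|i s IH].
  under eq_fun do rewrite big_nil.
  under [X in is_diff_def _ _ X]eq_fun do rewrite big_nil.
  exact: is_diff_cst.
under eq_fun do rewrite big_cons.
under [X in is_diff_def _ _ X]eq_fun do rewrite big_cons.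
exact: is_diffD.
Qed.

Record bounded_jet (R : realType) (V W : normedModType R) (K : R) (f : V -> W) (x : V) :
  Prop := BoundedJet {
  jet_val : `|f x| <= K ;
  jet_diff : forall u, `|'d f x u| <= K * `|u| ;
  jet_diff2 : forall h u, `|diff2 f x h u| <= K * `|h| * `|u| ;
  jet_twice : twice_differentiable f x }.

Lemma near_dist_le (R : realType) (V : normedModType R) (x : V) (e : R) :
  0 < e -> \forall y \near x, `|y - x| <= e.
Proof.
move=> e0; near=> y; rewrite distrC; near: y.
by apply: cvgr_dist_le => //; exact: cvg_id.
Unshelve. all: by end_near. Qed.

Lemma near_sqr_dist_le (R : realType) (V : normedModType R) (x : V) (C e : R) :
  0 <= C -> 0 < e -> \forall y \near x, C * `|y - x| ^+ 2 <= e * `|y - x|.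
Proof.
move=> C0 e0; have C1 : 0 < C + 1 by rewrite ltr_wpDl.
have := near_dist_le x (divr_gt0 e0 C1); apply: filterS => y.
rewrite ler_pdivlMr // => h; rewrite expr2 mulrA ler_wpM2r //.
by apply: le_trans h; rewrite mulrC ler_wpM2l // lerDl.
Qed.

(** Fermat's rule for upper expansions: a small step against [v] changes the right-hand side by -t
    |v|^2 + (rho + e) t |v|, which is negative if rho + e < |v|. The slope [rho] collects the
    contributions that are estimated but not differentiated. *)
Lemma norm_le_first_order (R : realType) (X : completeNormedModType R)
  (ip : {dot X for idfun}) (x v : X) (rho : R) : hilbert_dot ip -> 0 <= rho ->
  (forall e, 0 < e -> \forall y \near x, 0 <= ip v (y - x) + (rho + e) * `|y - x|) ->
  `|v| <= rho.
Proof.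
move=> hX rho0 H; have hfX := hilbert_form_dot hX.
have [->|vn0] := eqVneq v 0; first by rewrite normr0.
have v0 : 0 < `|v| by rewrite normr_gt0.
rewrite leNgt; apply/negP => rv.
pose e := (`|v| - rho) / 2; have e0 : 0 < e by rewrite divr_gt0 // subr_gt0.
have /nbhs_ballP [d /= d0 hd] := H e e0.
(* This puts [x - t *: v] at distance d / 2 from [x], inside the ball of radius d. *)
pose t := d / 2 / `|v|; have t0 : 0 < t by rewrite !divr_gt0.
have := hd (x - t *: v); rewrite -ball_normE /= opprB addrCA subrr addr0.
rewrite addrAC subrr add0r normrN normrZ gtr0_norm // /t divfK ?gt_eqF // -/t.
have d2 : d / 2 < d by move: d0; lra.
move=> /(_ d2); rewrite (hfNr hfX) (hfZr hfX) hX leNgt => /negP; apply.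
have -> : d / 2 = t * `|v| by rewrite /t divfK // gt_eqF.
have -> : - (t * `|v| ^+ 2) + (rho + e) * (t * `|v|) = - (t * `|v| * e).
  by rewrite /e; field.
by rewrite oppr_lt0; apply: mulr_gt0 => //; exact: mulr_gt0.
Qed.

Lemma norm_le_dual (R : realType) (X : completeNormedModType R)
  (ip : {dot X for idfun}) (v : X) (B : R) : hilbert_dot ip -> 0 <= B ->
  (forall h, ip v h <= B * `|h|) -> `|v| <= B.
Proof.
move=> hX B0 /(_ v); rewrite hX expr2; have [->|vn0] := eqVneq v 0.
  by rewrite normr0.
by rewrite ler_pM2r ?normr_gt0.
Qed.

Lemma bounded_jet_mono (R : realType) (V W : normedModType R) (K L : R) (f : V -> W) x :
  K <= L -> bounded_jet K f x -> bounded_jet L f x.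
Proof.
move=> KL [h1 h2 h3 h4]; split=> //; first exact: le_trans KL.
- by move=> u; apply: (le_trans (h2 u)); rewrite ler_wpM2r.
- by move=> h u; apply: (le_trans (h3 h u)); rewrite ler_wpM2r // ler_wpM2r.
Qed.

Lemma uniform_bounded_jet (R : realType) (V W : normedModType R) (A : set V) (f : V -> W) :
  bounded_C2_on A f -> (forall x, A x -> twice_differentiable f x) ->
  exists2 K, 0 <= K & forall x, A x -> bounded_jet K f x.
Proof.
move=> [[K1 h1] [K2 h2] [K3 h3]] tw; exists (`|K1| + `|K2| + `|K3|).
  by rewrite !addr_ge0.
move=> x Ax; split; last exact: tw.
- apply: (le_trans (h1 x Ax)); apply: (le_trans (ler_norm _)).
  by rewrite -addrA lerDl addr_ge0.
- move=> u; apply: (le_trans (h2 x Ax u)); rewrite ler_wpM2r //.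
  by apply: (le_trans (ler_norm _)); rewrite addrAC lerDr addr_ge0.
- move=> h u; apply: (le_trans (h3 x Ax h u)); rewrite ler_wpM2r // ler_wpM2r //.
  by apply: (le_trans (ler_norm _)); rewrite lerDr addr_ge0.
Qed.

Lemma bounded_set_ex (R : realType) (V : normedModType R) (A : set V) :
  bounded_set A -> exists B, forall x, A x -> `|x| <= B.
Proof.
move=> [B [_ hB]]; exists (B + 1) => x Ax.
by apply: (hB (B + 1)) => //; rewrite ltrDl.
Qed.

(** Expanding the square around [S x], only the cross term is of first order. The slope is thus
    proportional to the size of [S x], which for eta is small near KKT points; no derivative of [S]
    is needed. *)
Lemma sqr_expansion (R : realType) (X V : normedModType R) (d : V -> V -> R)
    (S : X -> V) (x : X) (C e : R) : hilbert_form d -> 0 <= C -> 0 < e ->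
  (\forall y \near x, fnorm d (S y - S x) <= C * `|y - x|) ->
  \forall y \near x,
    2^-1 * d (S y) (S y) - 2^-1 * d (S x) (S x) <= (fnorm d (S x) * C + e) * `|y - x|.
Proof.
move=> hd C0 e0 hS; near=> y.
have h1 : fnorm d (S y - S x) <= C * `|y - x| by near: y.
have h2 : C ^+ 2 / 2 * `|y - x| ^+ 2 <= e * `|y - x|.
  by near: y; apply: near_sqr_dist_le => //; rewrite divr_ge0 ?sqr_ge0.
have -> : S y = S x + (S y - S x) by rewrite addrC subrK.
rewrite !(hfDl hd (S x)) !(hfDr hd (S x)) (hf_sym hd (S y - S x)).
have h3 := le_trans (hf_leCS hd (S x) (S y - S x)) (ler_wpM2l (fnorm_ge0 _) h1).
have h4 : d (S y - S x) (S y - S x) <= (C * `|y - x|) ^+ 2.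
  by rewrite -(sqr_fnorm hd) lerXn2r ?nnegrE ?fnorm_ge0 // mulr_ge0.
move: h2 h3 h4; rewrite exprMn mulrDl; lra.
Unshelve. all: by end_near. Qed.

(** * The KKT operator *)

Section KKTOperator.
Context {R : realType} {X H : completeNormedModType R} {m : nat}.
Variables (ipX : {dot X for idfun}) (ipH : {dot H for idfun}).
Variables (f : X -> R) (F : X -> H) (g : 'I_m -> X -> R).
Hypotheses (hX : hilbert_dot ipX) (hH : hilbert_dot ipH).
Hypotheses (fD : forall x, differentiable f x) (FD : forall x, differentiable F x).
Hypothesis gD : forall i x, differentiable (g i) x.
Implicit Types (x h : X) (v w : H * 'rV[R]_m).

Let hfX := hilbert_form_dot hX.
Let hfH := hilbert_form_dot hH.
Let hfE := hilbert_form_edot R m.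

(* In block form constraint_map is A = (DF, nabla g), constraint_adj is A* and
   slack_map is diag(0, g^2); the pair w stands for (lambda, mu). *)
Definition mult_dot v w : R := ipH v.1 w.1 + edot v.2 w.2.
Definition constraint_map x h : H * 'rV[R]_m := ('d F x h, nabla_g ipX g x h).
Definition constraint_adj x w : X :=
  adjoint ipX ipH ('d F x) w.1 + \sum_(i < m) w.2 ord0 i *: grad ipX (g i) x.
Definition slack_map x w : H * 'rV[R]_m := (0, \row_i (g i x ^+ 2 * w.2 ord0 i)).
Definition kkt_op x w := constraint_map x (constraint_adj x w) + slack_map x w.
Definition lagr_grad x w := grad_lagrangian ipX ipH f F g x w.1 w.2.
Definition kkt_residual x w := constraint_map x (lagr_grad x w) + slack_map x w.

Lemma hilbert_form_mult_dot : hilbert_form mult_dot.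
Proof. exact: hilbert_form_prod. Qed.
Let hpd := hilbert_form_mult_dot.

Lemma nabla_gE x h : nabla_g ipX g x h = \row_i 'd (g i) x h.
Proof. by apply/rowP => i; rewrite !mxE gradE. Qed.

Lemma constraint_map_linear x a h k : constraint_map x (a *: h + k) = a *: constraint_map x h + constraint_map x k.
Proof.
rewrite /constraint_map !nabla_gE; congr pair; first by rewrite linearP.
by apply/rowP => i; rewrite !mxE linearP.
Qed.

Lemma constraint_mapD x h k : constraint_map x (h + k) = constraint_map x h + constraint_map x k.
Proof. by have := constraint_map_linear x 1 h k; rewrite !scale1r. Qed.

Lemma constraint_map_adj x h w : mult_dot (constraint_map x h) w = ipX h (constraint_adj x w).
Proof.
rewrite /mult_dot /= (adjointE hX hH) // hfDr //; congr (_ + _).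
rewrite (hf_sym hfX) (hf_suml hfX); apply: eq_bigr => i _.
by rewrite (hfZl hfX) mxE mulrC.
Qed.

(** The adjoint is a chosen representative, so linearity is obtained by testing against every h and
    passing to [constraint_map]. *)
Lemma constraint_adj_linear x a v w : constraint_adj x (a *: v + w) = a *: constraint_adj x v + constraint_adj x w.
Proof.
apply/subr0_eq/(hf_eq0r hfX) => h.
rewrite (hf_sym hfX) (hfBr hfX) (hfDr hfX (a *: constraint_adj x v)) (hfZr hfX) -!constraint_map_adj.
by rewrite (hfDr hpd) (hfZr hpd) subrr.
Qed.

Lemma constraint_adjD x v w : constraint_adj x (v + w) = constraint_adj x v + constraint_adj x w.
Proof. by have := constraint_adj_linear x 1 v w; rewrite !scale1r. Qed.

Lemma slack_map_linear x a v w : slack_map x (a *: v + w) = a *: slack_map x v + slack_map x w.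
Proof.
apply/pair_equal_spec; split; first by rewrite /= scaler0 addr0.
by apply/rowP => i; rewrite !mxE; ring.
Qed.

Lemma slack_mapD x v w : slack_map x (v + w) = slack_map x v + slack_map x w.
Proof. by have := slack_map_linear x 1 v w; rewrite !scale1r. Qed.

Lemma slack_map_sym x v w : mult_dot (slack_map x v) w = mult_dot v (slack_map x w).
Proof.
rewrite /mult_dot /= (hf0l hfH) (hf0r hfH) !add0r; apply: eq_bigr => i _.
by rewrite !mxE; ring.
Qed.

Lemma kkt_op_linear x a v w : kkt_op x (a *: v + w) = a *: kkt_op x v + kkt_op x w.
Proof. by rewrite /kkt_op constraint_adj_linear constraint_map_linear slack_map_linear scalerDr addrACA. Qed.

Lemma kkt_op_sym x v w : mult_dot (kkt_op x v) w = mult_dot v (kkt_op x w).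
Proof.
rewrite /kkt_op (hfDl hpd) (hfDr hpd) slack_map_sym constraint_map_adj (hf_sym hfX) -constraint_map_adj.
by rewrite (hf_sym hpd).
Qed.

Lemma is_diff_lagrangian x w :
  is_diff x (fun y => lagrangian ipH f F g y w.1 w.2)
   (fun h => 'd f x h + ipH w.1 ('d F x h) + \sum_i w.2 ord0 i * 'd (g i) x h).
Proof.
have -> : (fun y => lagrangian ipH f F g y w.1 w.2) =
   f + (fun y => ipH w.1 (F y)) + (fun y => \sum_i (w.2 ord0 i *: g i y)).
  apply/funext => y; rewrite /lagrangian /edot; congr (_ + _).
  by apply: eq_bigr => i _; rewrite mxE.
apply: is_diffD; first apply: is_diffD.
- exact: differentiableP.
- exact: is_diff_hf.
- by apply: is_diff_sum => i; apply: is_diffZ; exact: differentiableP.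
Qed.

Lemma lagr_gradE x w h :
  ipX (lagr_grad x w) h = 'd f x h + ipH w.1 ('d F x h) + \sum_i w.2 ord0 i * 'd (g i) x h.
Proof.
have [dL dLE] := is_diff_lagrangian x w.
by rewrite /lagr_grad /grad_lagrangian (gradE hX _ dL) dLE.
Qed.

Lemma lagr_grad_decomp x w : lagr_grad x w = grad ipX f x + constraint_adj x w.
Proof.
apply/subr0_eq/(hf_eq0r hfX) => h.
rewrite (hfBl hfX) lagr_gradE (hfDl hfX) gradE // (hf_sym hfX _ h) -constraint_map_adj (hf_sym hpd).
rewrite /mult_dot /= nabla_gE; apply/eqP; rewrite subr_eq0 -addrA; apply/eqP.
by congr (_ + (_ + _)); apply: eq_bigr => i _; rewrite mxE.
Qed.

(** The gradient of the Lagrangian is affine in the multipliers with linear part [constraint_adj].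
    Hence eta is a quadratic polynomial in the multipliers whose leading part is [Qform]. *)
Lemma kkt_residualD x v w : kkt_residual x (v + w) = kkt_residual x v + kkt_op x w.
Proof.
rewrite /kkt_residual /kkt_op !lagr_grad_decomp.
by rewrite constraint_adjD slack_mapD (addrA (grad ipX f x)) (constraint_mapD _ _ (constraint_adj x w)) addrACA.
Qed.

Lemma etaE x w : eta ipX ipH f F g x w.1 w.2 = 2^-1 * mult_dot (kkt_residual x w) (kkt_residual x w).
Proof.
rewrite /mult_dot /kkt_residual /= addr0 mulrDr hH; congr (_ + _ * _).
by apply: eq_bigr => i _; rewrite !mxE expr2.
Qed.

Lemma QformE x w : Qform ipX ipH F g x w.1 w.2 = 2^-1 * mult_dot (kkt_op x w) (kkt_op x w).
Proof.
rewrite /Qform /mult_dot /kkt_op /= addr0 mulrDr hH; congr (_ + _ * _).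
rewrite (sqr_fnorm hfE); congr edot; congr (_ + _).
all: by apply/rowP => i; rewrite mul_mx_diag !mxE mulrC.
Qed.

Lemma fnorm_mult_dot_le v : fnorm mult_dot v <= `|v.1| + \sum_i `|v.2 ord0 i|.
Proof.
have s0 : 0 <= \sum_i `|v.2 ord0 i| by apply: sumr_ge0.
rewrite -(@ler_pXn2r _ 2) ?nnegrE ?addr_ge0 ?fnorm_ge0 //.
rewrite (sqr_fnorm hpd) /mult_dot hH sqrrD -addrA lerD2l.
apply: (@le_trans _ _ ((\sum_i `|v.2 ord0 i|) ^+ 2)); last by rewrite lerDr mulrn_wge0 // mulr_ge0.
rewrite expr2 mulr_suml; apply: ler_sum => i _.
rewrite -expr2 -real_normK ?num_real // expr2 ler_wpM2l //.
by rewrite (bigD1 i) //= lerDl sumr_ge0.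
Qed.

Lemma le_fnorm_mult_dot1 v : `|v.1| <= fnorm mult_dot v.
Proof.
rewrite -(fnorm_dot hH); apply: ler_wsqrtr; rewrite lerDl; exact: (hf_ge0 hfE).
Qed.

Lemma le_fnorm_mult_dot2 v : enorm v.2 <= fnorm mult_dot v.
Proof. by apply: ler_wsqrtr; rewrite lerDr; exact: (hf_ge0 hfH). Qed.

Record bounded_data (K : R) x : Prop := BoundedData {
  bd_f : bounded_jet K f x ;
  bd_F : bounded_jet K F x ;
  bd_g : forall i, bounded_jet K (g i) x }.

Lemma constraint_map_bound (K : R) x h : bounded_data K x ->
  fnorm mult_dot (constraint_map x h) <= (m%:R + 1) * K * `|h|.
Proof.
move=> [_ jF jg]; apply: (le_trans (fnorm_mult_dot_le _)).
rewrite /= mulrDl mul1r mulrDl addrC; apply: lerD; last exact: jet_diff jF _.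
rewrite -mulrA mulr_natl -[m in _ *+ m]card_ord -sumr_const; apply: ler_sum => i _.
by rewrite nabla_gE mxE; exact: jet_diff (jg i) _.
Qed.

(** The quantifier order matters: [C] depends on the bounds for the data and for the multipliers,
    not on the point, so it is fixed before c. *)
Lemma kkt_residual_lipschitz (K L : R) : 0 <= K -> 0 <= L -> exists2 C, 0 < C &
  forall x w, bounded_data K x -> fnorm mult_dot w <= L ->
  \forall y \near x,
   fnorm mult_dot (kkt_residual y w - kkt_residual x w) <= C * `|y - x|.
Proof.
move=> K0 L0.
(* Total weight of f, F and the m functions g_i in the Lagrangian when the multipliers are bounded
   by [L]. *)
pose L1 := 1 + L + m%:R * L.
have m0 : 0 <= m%:R :> R by [].
have L1_ge1 : 1 <= L1 by rewrite /L1 -addrA lerDl addr_ge0 // mulr_ge0.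
(* The sum of (K + 1)(2 K + 1) L1, from varying the derivative, and K (K + 1) L1, from varying the
   gradient. It also bounds the increment of g_i^2 mu_i, so F contributes it once and each g_i
   twice. *)
pose C1 := (K + 1) * (3 * K + 1) * L1.
exists ((1 + 2 * m%:R) * C1).
  have L1_gt0 : 0 < L1 by exact: lt_le_trans L1_ge1.
  have K1 : 0 < K + 1 by rewrite ltr_wpDl.
  have K3 : 0 < 3 * K + 1 by rewrite ltr_wpDl // mulr_ge0.
  have m1 : 0 < 1 + 2 * m%:R :> R by rewrite ltr_wpDr // mulr_ge0.
  by apply: mulr_gt0 => //; apply: mulr_gt0 => //; exact: mulr_gt0.
move=> x w bd wL.
have w1 : `|w.1| <= L by apply: le_trans wL; exact: le_fnorm_mult_dot1.
have w2 i : `|w.2 ord0 i| <= L.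
  by apply: le_trans wL; apply: le_trans (le_fnorm_mult_dot2 _); exact: le_enorm.
have [jf jF jg] := bd.
near=> y.
have d1 : `|y - x| <= 1 by near: y; exact: near_dist_le.
have lf : forall u, `|'d f y u - 'd f x u| <= (K + 1) * `|y - x| * `|u|.
  by near: y; apply: twice_diff_lipschitz; [exact: jet_twice jf|exact: jet_diff2 jf].
have lF : forall u, `|'d F y u - 'd F x u| <= (K + 1) * `|y - x| * `|u|.
  by near: y; apply: twice_diff_lipschitz; [exact: jet_twice jF|exact: jet_diff2 jF].
have lg : forall i u, `|'d (g i) y u - 'd (g i) x u| <= (K + 1) * `|y - x| * `|u|.
  near: y; apply: filter_forall => i.
  by apply: twice_diff_lipschitz; [exact: jet_twice (jg i)|exact: jet_diff2 (jg i)].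
have lg0 : forall i, `|g i y - g i x| <= (K + 1) * `|y - x|.
  by near: y; apply: filter_forall => i; apply: diff_lipschitz => //; exact: jet_diff (jg i).
pose u z := lagr_grad z w.
have sum_le (s : 'I_m -> R) (B : R) : (forall i, s i <= B) -> \sum_i s i <= m%:R * B.
  move=> hs; rewrite mulr_natl -[m in _ *+ m]card_ord -sumr_const; exact: ler_sum.
have K1 : 0 <= K + 1 by rewrite addr_ge0.
have L10 : 0 <= L1 by exact: le_trans L1_ge1.
have comb (df dF : R) (dg : 'I_m -> R) (B : R) : 0 <= B -> `|df| <= B -> `|dF| <= L * B ->
    (forall i, `|dg i| <= B) -> df + dF + \sum_i w.2 ord0 i * dg i <= B * L1.
  move=> B0 h1 h2 h3.
  have -> : B * L1 = B + L * B + m%:R * (L * B) by rewrite /L1; ring.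
  apply: lerD; first by apply: lerD; apply: le_trans (ler_norm _) _.
  apply: sum_le => i; apply: (le_trans (ler_norm _)); rewrite normrM.
  by apply: ler_pM.
have ipF (a : H) B : `|a| <= B -> `|ipH w.1 a| <= L * B.
  move=> aB; apply: (le_trans (hf_CS hfH _ _)); rewrite !(fnorm_dot hH).
  by apply: ler_pM.
have ux : `|u x| <= K * L1.
  apply: norm_le_dual hX _ _; first exact: mulr_ge0.
  move=> h; rewrite /u lagr_gradE mulrAC; apply: comb.
  - exact: mulr_ge0.
  - exact: jet_diff jf _.
  - apply: ipF; exact: jet_diff jF _.
  - by move=> i; exact: jet_diff (jg i) _.
have uyx : `|u y - u x| <= (K + 1) * L1 * `|y - x|.
  apply: norm_le_dual hX _ _; first by rewrite !mulr_ge0.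
  move=> h; rewrite (hfBl hfX) /u !lagr_gradE.
  have -> : (K + 1) * L1 * `|y - x| * `|h| = (K + 1) * `|y - x| * `|h| * L1 by ring.
  have -> : forall a b c a' b' c' : R, a + b + c - (a' + b' + c') = (a - a') + (b - b') + (c - c').
    by move=> *; ring.
  rewrite -(hfBr hfH) -sumrB; under eq_bigr do rewrite -mulrBr.
  apply: comb => //; first by rewrite !mulr_ge0.
  exact: ipF.
have uy : `|u y| <= (2 * K + 1) * L1.
  rewrite -(subrK (u x) (u y)); apply: (le_trans (ler_normD _ _)).
  have -> : (2 * K + 1) * L1 = (K + 1) * L1 + K * L1 by ring.
  apply: lerD => //; apply: (le_trans uyx).
  by rewrite ler_piMr // mulr_ge0.
have comp (W : normedModType R) (T : X -> W) : bounded_jet K T x ->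
   (forall u, `|'d T y u - 'd T x u| <= (K + 1) * `|y - x| * `|u|) ->
   `|'d T y (u y) - 'd T x (u x)| <= C1 * `|y - x|.
  move=> jT lT.
  have -> : 'd T y (u y) - 'd T x (u x) = ('d T y (u y) - 'd T x (u y)) + 'd T x (u y - u x).
    by rewrite linearB addrA subrK.
  apply: (le_trans (ler_normD _ _)).
  have -> : C1 * `|y - x| = (K + 1) * `|y - x| * ((2 * K + 1) * L1) + K * ((K + 1) * L1 * `|y - x|).
    by rewrite /C1; ring.
  apply: lerD.
    by apply: (le_trans (lT _)); rewrite ler_wpM2l // mulr_ge0.
  by apply: (le_trans (jet_diff jT _)); rewrite ler_wpM2l.
apply: (le_trans (fnorm_mult_dot_le _)).
rewrite /= !addr0 -mulrA mulrDl mul1r.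
apply: lerD; first exact: (comp _ F jF lF).
rewrite [2 * m%:R]mulrC -mulrA; apply: sum_le => i.
rewrite !nabla_gE !mxE.
have -> : forall a b a' b' : R, a + b - (a' + b') = (a - a') + (b - b') by move=> *; ring.
rewrite mulr_natl mulr2n; apply: (le_trans (ler_normD _ _)).
apply: lerD; first exact: (comp _ (g i) (jg i) (lg i)).
rewrite -mulrBl subr_sqr !normrM.
have gy : `|g i y + g i x| <= 3 * K + 1.
  rewrite -(subrK (g i x) (g i y)) -addrA; apply: (le_trans (ler_normD _ _)).
  have -> : 3 * K + 1 = (K + 1) + (K + K) by ring.
  apply: lerD; first by apply: (le_trans (lg0 i)); rewrite ler_piMr.
  by apply: (le_trans (ler_normD _ _)); apply: lerD; exact: jet_val (jg i).
have -> : C1 * `|y - x| = (K + 1) * `|y - x| * (3 * K + 1) * L1 by rewrite /C1; ring.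
apply: ler_pM => //; first by apply: ler_pM.
apply: (le_trans (w2 i)); rewrite /L1 -addrA addrCA lerDl addr_ge0 // mulr_ge0 //.
Unshelve. all: by end_near. Qed.
End KKTOperator.

(** * Penalty and weight functions *)

Section PenaltyFunction.
Context {R : realType} (phi : R -> \bar R) (phi_adm : admissible_phi phi).

Lemma phi0 : phi 0 = 0%E.
Proof. by apply/(phi_eq0 phi_adm). Qed.

Lemma edom0 : edom phi 0.
Proof. by split=> //; rewrite phi0. Qed.

Lemma fine_phi t : edom phi t -> phi t = (fine (phi t))%:E.
Proof.
by move=> [t0 ti]; rewrite fineK // ge0_fin_numE //; exact: (phi_ge0 phi_adm).
Qed.

Lemma edom_le s t : 0 <= s -> s <= t -> edom phi t -> edom phi s.
Proof.
by move=> s0 st [_ ti]; split=> //; apply: le_lt_trans ti; exact: (phi_nondecreasing phi_adm).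
Qed.

Lemma near0_le (P : R -> Prop) : (\forall s \near (0 : R), P s) ->
  exists2 d, 0 < d & forall s, 0 <= s -> s <= d -> P s.
Proof.
move=> /nbhs_ballP [d /= d0 hd]; exists (d / 2); first by rewrite divr_gt0.
move=> s s0 sd; apply: hd; rewrite -ball_normE /= sub0r normrN ger0_norm //.
by apply: (le_lt_trans sd); move: d0; lra.
Qed.

(** Near 0 the slope [sigma] gives the bound. Any other t is scaled into that neighbourhood by a =
    min(1, d / t), and convexity with phi(0) = 0 yields phi(a t) <= a phi(t). *)
Lemma phi_lower sigma : 0 < sigma ->
  has_diff_within (edom phi) (fun s => fine (phi s) : R) 0 (fun t => sigma * t) ->
  forall t, edom phi t -> sigma / 2 * t <= fine (phi t).
Proof.
move=> s0 hd t dt; have [t0 _] := dt.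
have [->|tn0] := eqVneq t 0; first by rewrite mulr0 phi0.
have tp : 0 < t by rewrite lt_def tn0.
have s2 : 0 < sigma / 2 by rewrite divr_gt0.
have h : \forall s \near (0 : R), edom phi s ->
   `|fine (phi s) - fine (phi 0) - sigma * (s - 0)| <= sigma / 2 * `|s - 0|.
  exact: hd s2.
have [d d0 hd2] := near0_le h.
pose a := Num.min 1 (d / t).
have a0 : 0 < a by rewrite lt_min ltr01 divr_gt0.
have a1 : a <= 1 by rewrite ge_min lexx.
have ad : a * t <= d by rewrite -ler_pdivlMr // ge_min lexx orbT.
have at0 : 0 <= a * t by rewrite mulr_ge0 // ltW.
have dat : edom phi (a * t) by apply: edom_le dt => //; rewrite ler_piMl.
have := hd2 _ at0 ad dat; rewrite phi0 !subr0 (ger0_norm at0) ler_norml => /andP[h1 _].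
have := phi_convex phi_adm t0 (lexx 0) (ltW a0) a1.
rewrite mulr0 addr0 phi0 mule0 adde0 (fine_phi dat) (fine_phi dt) -EFinM lee_fin => h2.
have : a * (sigma / 2 * t) <= a * fine (phi t) by move: h1 h2; lra.
by rewrite ler_pM2l.
Qed.

Lemma phi_local dphi : 0 < dphi 0 ->
  has_diff_within (edom phi) (fun s => fine (phi s) : R) 0 (fun t => dphi 0 * t) ->
  {within edom phi, continuous dphi} ->
  exists2 d, 0 < d & forall t, edom phi t -> t <= d ->
   fine (phi t) <= (dphi 0 + 1) * t /\ dphi 0 / 2 <= dphi t.
Proof.
move=> s0 hd /subspace_continuousP /(_ _ edom0) cd.
have s2 : 0 < dphi 0 / 2 by rewrite divr_gt0.
have h1 : \forall s \near (0 : R), edom phi s ->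
   `|fine (phi s) - fine (phi 0) - dphi 0 * (s - 0)| <= 1 * `|s - 0|.
  exact: hd ltr01.
have h2 : \forall s \near (0 : R), edom phi s -> `|dphi 0 - dphi s| <= dphi 0 / 2.
  by have /cvgrPdist_le /(_ _ s2) := cd.
have [d1 d10 hd1] := near0_le h1; have [d2 d20 hd2] := near0_le h2.
exists (Num.min d1 d2); first by rewrite lt_min d10.
move=> t dt; have [t0 _] := dt; rewrite le_min => /andP[td1 td2]; split.
  have := hd1 t t0 td1 dt; rewrite phi0 !subr0 (ger0_norm t0) ler_norml => /andP[_]; lra.
by have := hd2 t t0 td2 dt; rewrite ler_norml => /andP[_]; lra.
Qed.
End PenaltyFunction.

Section Penalty.
Context {R : realType} {X H : completeNormedModType R}.
Variables (ipH : {dot H for idfun}) (F : X -> H) (phi : R -> \bar R).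
Hypotheses (hH : hilbert_dot ipH) (phi_adm : admissible_phi phi).
Let hfH := hilbert_form_dot hH.

(** In both alternatives of [phi_coercive] the domain is relatively open in the half-line, so phi
    stays finite under small perturbations of x. *)
Lemma edom_open t : edom phi t -> \forall s \near t, 0 <= s -> edom phi s.
Proof.
case: (phi_coercive phi_adm) => [[-> _] _|[al al0 [-> _]] /= /andP[t0 ta]].
  by near=> s.
near=> s; move=> s0; rewrite /= s0 /=; near: s; exact: lt_nbhsl.
Unshelve. all: by end_near. Qed.

Lemma cont_sqr_norm x : differentiable F x ->
  `|F y| ^+ 2 @[y --> x] --> `|F x| ^+ 2.
Proof.
move=> dF; have := differentiable_continuous dF => cF.
by apply: cvgM; apply: cvg_norm.
Qed.

Lemma near_edom x : differentiable F x -> edom phi (`|F x| ^+ 2) ->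
  \forall y \near x, edom phi (`|F y| ^+ 2).
Proof.
move=> dF /edom_open h; have h' : \forall y \near x, 0 <= `|F y| ^+ 2 -> edom phi (`|F y| ^+ 2).
  by have := cont_sqr_norm dF h.
by apply: filterS h' => y; apply; exact: sqr_ge0.
Qed.

Lemma phi_expansion x (dphi e : R) : differentiable F x ->
  edom phi (`|F x| ^+ 2) ->
  has_diff_within (edom phi) (fun s => fine (phi s) : R) (`|F x| ^+ 2) (fun h => dphi * h) ->
  0 < e -> \forall y \near x,
    fine (phi (`|F y| ^+ 2)) - fine (phi (`|F x| ^+ 2)) <=
    2 * dphi * ipH (F x) (F y - F x) + e * `|y - x|.
Proof.
move=> dF dom hphi e0.
have [K K0 hK] := diff_bounded dF.
(* A Lipschitz constant of |F|^2 at x, valid once |F y - F x| <= 1. Half of [e] pays for the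
   remainder of phi, half for the quadratic term |F y - F x|^2. *)
pose C := (2 * `|F x| + 1) * (K + 1).
have C0 : 0 < C by rewrite mulr_gt0 // ltr_wpDl // ?mulr_ge0 // ltW.
have eC : 0 < e / 2 / C by rewrite !divr_gt0.
have hw : \forall s \near `|F x| ^+ 2, edom phi s ->
   `|fine (phi s) - fine (phi (`|F x| ^+ 2)) - dphi * (s - `|F x| ^+ 2)|
   <= e / 2 / C * `|s - `|F x| ^+ 2|.
  exact: hphi eC.
have hw2 := cont_sqr_norm dF hw.
near=> y.
have dy : edom phi (`|F y| ^+ 2) by near: y; exact: near_edom.
have lip : `|F y - F x| <= (K + 1) * `|y - x| by near: y; exact: diff_lipschitz.
have lip1 : `|F y - F x| <= 1.
  by near: y; have := differentiable_continuous dF => /cvgrPdist_le /(_ 1 ltr01);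
     apply: filterS => y; rewrite distrC.
have sm : `|dphi| * (K + 1) ^+ 2 * `|y - x| ^+ 2 <= e / 2 * `|y - x|.
  by near: y; apply: near_sqr_dist_le; rewrite ?divr_gt0 // mulr_ge0 ?sqr_ge0.
have /(_ dy) h : edom phi (`|F y| ^+ 2) ->
   `|fine (phi (`|F y| ^+ 2)) - fine (phi (`|F x| ^+ 2)) - dphi * (`|F y| ^+ 2 - `|F x| ^+ 2)|
   <= e / 2 / C * `| `|F y| ^+ 2 - `|F x| ^+ 2| by near: y; exact: hw2.
have sq : `|F y| ^+ 2 - `|F x| ^+ 2 = 2 * ipH (F x) (F y - F x) + `|F y - F x| ^+ 2.
  have := subrK (F x) (F y); move: (F y - F x) => b <-.
  by rewrite -!hH !(hfDl hfH, hfDr hfH) (hf_sym hfH b); ring.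
have sqle : `| `|F y| ^+ 2 - `|F x| ^+ 2| <= C * `|y - x|.
  rewrite sq; apply: (le_trans (ler_normD _ _)); rewrite normrM gtr0_norm // [`|_ ^+ 2|]ger0_norm ?sqr_ge0 //.
  have := hf_CS hfH (F x) (F y - F x); rewrite !(fnorm_dot hH) => cs.
  apply: (@le_trans _ _ ((2 * `|F x| + 1) * `|F y - F x|)).
    have -> : (2 * `|F x| + 1) * `|F y - F x| = 2 * (`|F x| * `|F y - F x|) + `|F y - F x| by ring.
    by apply: lerD; [rewrite ler_pM2l | rewrite expr2 ler_piMr].
  by rewrite /C -mulrA ler_wpM2l // addr_ge0 // mulr_ge0.
have h2 : e / 2 / C * `| `|F y| ^+ 2 - `|F x| ^+ 2| <= e / 2 * `|y - x|.
  by apply: (le_trans (ler_wpM2l (ltW eC) sqle)); rewrite mulrA divfK // gt_eqF.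
have h3 : dphi * `|F y - F x| ^+ 2 <= e / 2 * `|y - x|.
  apply: le_trans sm; apply: (le_trans (ler_norm _)); rewrite normrM -mulrA.
  by rewrite ler_wpM2l // ger0_norm ?sqr_ge0 // -exprMn lerXn2r ?nnegrE // mulr_ge0 // addr_ge0 // ltW.
move: (le_trans (ler_norm _) (le_trans h h2)) h3; rewrite sq; lra.
Unshelve. all: by end_near. Qed.
End Penalty.

Section Weight.
Context {R : realType} {X : completeNormedModType R} {m : nat}.
Variables (g : 'I_m -> X -> R) (psi : 'rV[R]_m -> R).
Hypothesis gD : forall i x, differentiable (g i) x.

Lemma vmax0_orthant (u : 'rV[R]_m) : orthant (vmax u 0).
Proof. by move=> i; rewrite !mxE le_max lexx orbT. Qed.

Lemma vmax0_lipschitz (u v : 'rV[R]_m) (B : R) : 0 <= B ->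
  (forall i, `|u ord0 i - v ord0 i| <= B) -> `|vmax u 0 - vmax v 0| <= B.
Proof.
move=> B0 h; apply: norm_le_coord => // i; rewrite !mxE.
move: (h i); rewrite !ler_norml => /andP[h1 h2].
by case: (lerP 0 (u ord0 i)); case: (lerP 0 (v ord0 i)); lra.
Qed.

(** Positive parts are 1-Lipschitz and stay in the orthant, where [psi] has its relative expansion.
    The factor m passes from the sup norm to the pairing [edot]. *)
Lemma bfun_lipschitz (K D : R) (dpsi : 'rV[R]_m -> 'rV[R]_m) x :
  0 <= K -> 0 <= D ->
  has_diff_within orthant psi (vmax (gvec g x) 0) (edot (dpsi (vmax (gvec g x) 0))) ->
  `|dpsi (vmax (gvec g x) 0)| <= D ->
  (forall i h, `|'d (g i) x h| <= K * `|h|) ->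
  \forall y \near x, `|bfun g psi y - bfun g psi x| <= (m%:R * D + 1) * (K + 1) * `|y - x|.
Proof.
move=> K0 D0; set Y := vmax (gvec g x) 0 => dY DY hg.
have /= hw : \forall Y' \near Y, orthant Y' ->
   `|psi Y' - psi Y - edot (dpsi Y) (Y' - Y)| <= 1 * `|Y' - Y|.
  exact: dY ltr01.
have lip : \forall y \near x, `|vmax (gvec g y) 0 - Y| <= (K + 1) * `|y - x|.
  near=> y; apply: vmax0_lipschitz; first by rewrite mulr_ge0 // addr_ge0.
  move=> i; rewrite !mxE; move: i; near: y; apply: filter_forall => i.
  exact: diff_lipschitz.
have cY : vmax (gvec g y) 0 @[y --> x] --> Y.
  apply/cvgrPdist_le => e e0; near=> y; rewrite distrC.
  apply: (@le_trans _ _ ((K + 1) * `|y - x|)); first by near: y.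
  rewrite mulrC -ler_pdivlMr; last by rewrite ltr_wpDl.
  by near: y; apply: near_dist_le; rewrite divr_gt0 // ltr_wpDl.
have hw2 : \forall y \near x, orthant (vmax (gvec g y) 0) ->
   `|psi (vmax (gvec g y) 0) - psi Y - edot (dpsi Y) (vmax (gvec g y) 0 - Y)|
     <= 1 * `|vmax (gvec g y) 0 - Y|.
  by have := cY _ hw.
near=> y.
have l1 : `|vmax (gvec g y) 0 - Y| <= (K + 1) * `|y - x| by near: y.
have /(_ (vmax0_orthant _)) h : orthant (vmax (gvec g y) 0) ->
   `|psi (vmax (gvec g y) 0) - psi Y - edot (dpsi Y) (vmax (gvec g y) 0 - Y)|
     <= 1 * `|vmax (gvec g y) 0 - Y| by near: y.
rewrite /bfun -/Y -mulrA.
apply: (@le_trans _ _ ((m%:R * D + 1) * `|vmax (gvec g y) 0 - Y|)); last first.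
  by rewrite ler_wpM2l // addr_ge0 // mulr_ge0.
set Z := vmax (gvec g y) 0 - Y in h *.
rewrite -[_ - _](subrK (edot (dpsi Y) Z)); apply: (le_trans (ler_normD _ _)).
rewrite addrC mulrDl; apply: lerD => //.
apply: (le_trans (ler_norm_sum _ _ _)).
rewrite -mulrA mulr_natl -[m in _ *+ m]card_ord -sumr_const; apply: ler_sum => i _.
rewrite normrM; apply: ler_pM => //; last exact: coord_le_norm.
by apply: le_trans DY; exact: coord_le_norm.
Unshelve. all: by end_near. Qed.
End Weight.

(** The unconstrained minimiser is -mu / k. If it lies below gi, the slope mu + k gi at gi is
    nonnegative, and convexity makes gi minimal on the half-line. *)
Lemma max_minimises_quadratic (R : realFieldType) (mu gi y k : R) : 0 < k -> gi <= y ->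
  mu * Num.max gi (- k^-1 * mu) + k / 2 * Num.max gi (- k^-1 * mu) ^+ 2
  <= mu * y + k / 2 * y ^+ 2.
Proof.
move=> k0 gy; have [h|h] := leP gi (- k^-1 * mu).
  rewrite -subr_ge0.
  have -> : mu * y + k / 2 * y ^+ 2 - (mu * (- k^-1 * mu) + k / 2 * (- k^-1 * mu) ^+ 2)
     = k / 2 * (y + k^-1 * mu) ^+ 2 by field; rewrite gt_eqF.
  by rewrite mulr_ge0 ?sqr_ge0 // divr_ge0 // ltW.
have h2 : 0 <= mu + k * gi.
  have : k * (- k^-1 * mu) <= k * gi by rewrite ler_pM2l // ltW.
  by rewrite mulrA mulrN divff ?gt_eqF // mulN1r; lra.
have : 0 <= (y - gi) * (mu + k * gi) by rewrite mulr_ge0 // subr_ge0.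
have : 0 <= k / 2 * (y - gi) ^+ 2 by rewrite mulr_ge0 ?sqr_ge0 // divr_ge0 // ltW.
nra.
Qed.

(** * The Hestenes-Powell-Rockafellar term of the inequality constraints *)

Section Inequality.
Context {R : realType} {X : completeNormedModType R} {m : nat}.
Variables (g : 'I_m -> X -> R) (psi : 'rV[R]_m -> R).
Hypothesis gD : forall i x, differentiable (g i) x.
Let hfE := hilbert_form_edot R m.

Definition ineq_term (c : R) (mu : 'rV[R]_m) x : R :=
  edot mu (qvec g psi x mu c)
  + c / (2 * pfun g psi x mu) * enorm (qvec g psi x mu c) ^+ 2.

Lemma pfun_gt0 x mu : 0 < bfun g psi x -> 0 < pfun g psi x mu.
Proof. by move=> b0; rewrite divr_gt0 // ltr_wpDr // sqr_ge0. Qed.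

(* qvec minimises, componentwise, <mu, y> + c / (2 p) |y|^2 over y >= g x; any
   such y gives an upper bound, so the max in qvec need not be differentiated. *)
Lemma ineq_term_le (c : R) (mu y : 'rV[R]_m) x : 0 < c -> 0 < bfun g psi x ->
  (forall i, g i x <= y ord0 i) ->
  ineq_term c mu x <= edot mu y + c / (2 * pfun g psi x mu) * edot y y.
Proof.
move=> c0 b0 gy; have p0 := pfun_gt0 mu b0.
rewrite /ineq_term (sqr_fnorm hfE) /edot !mulr_sumr -!big_split; apply: ler_sum => i _ /=.
rewrite !mxE; set p := pfun _ _ _ _ in p0 *.
have -> : c / (2 * p) = (c / p) / 2 by field; rewrite gt_eqF.
have -> : - (c^-1 * p) = - (c / p)^-1 by rewrite invf_div mulrC.
by rewrite -!expr2 max_minimises_quadratic // divr_gt0.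
Qed.

Lemma qvec_ge x mu c i : g i x <= qvec g psi x mu c ord0 i.
Proof. by rewrite !mxE le_max lexx. Qed.

(** With D = g(y) - g(x), the vector q + D dominates g(y), so it may replace the exact [qvec] at y.
    What remains is smooth in D, apart from the variation of the coefficient c / p, which multiplies
    |q|^2 to first order. *)
Lemma ineq_expansion (c K Lb e : R) (mu : 'rV[R]_m) x :
  0 < c -> 0 <= K -> 0 <= Lb -> 0 < e -> 0 < bfun g psi x ->
  (forall i h, `|'d (g i) x h| <= K * `|h|) ->
  (\forall y \near x, `|bfun g psi y - bfun g psi x| <= Lb * `|y - x|) ->
  let q := qvec g psi x mu c in
  \forall y \near x, 0 < bfun g psi y /\
    ineq_term c mu y - ineq_term c mu x <=
      edot (mu + (c / pfun g psi x mu) *: q) (gvec g y - gvec g x)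
      + (2 * c * (1 + enorm mu ^+ 2) * Lb * enorm q ^+ 2 / bfun g psi x ^+ 2 + e) * `|y - x|.
Proof.
move=> c0 K0 L0 e0 b0 hg hb q.
have addE (u v : 'rV[R]_m) : edot (u + v) (u + v) = edot u u + 2 * edot u v + edot v v.
  by rewrite !(hfDl hfE, hfDr hfE) (hf_sym hfE v u); ring.
have subE (u v : 'rV[R]_m) : edot (u - v) (u - v) = edot u u - 2 * edot u v + edot v v.
  by rewrite !(hfBl hfE, hfBr hfE) (hf_sym hfE v u); ring.
set N := 1 + enorm mu ^+ 2.
have N0 : 0 < N by rewrite ltr_wpDr // sqr_ge0.
set b := bfun g psi in b0 hb *.
pose kx := c * N / b x.
have kx0 : 0 < kx by rewrite divr_gt0 // mulr_gt0.
(* Bounds the growth rate at x of the coefficient c N / b; the 2 comes from b y >= b x / 2. *)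
pose k2 := 2 * c * N * Lb / b x ^+ 2.
have k20 : 0 <= k2 by rewrite divr_ge0 ?sqr_ge0 // !mulr_ge0 // ltW.
pose Cg := m%:R * (K + 1).
have Cg0 : 0 <= Cg by rewrite mulr_ge0 // addr_ge0.
have C20 : 0 <= (kx / 2 + k2) * Cg ^+ 2.
  by rewrite mulr_ge0 ?sqr_ge0 // addr_ge0 // divr_ge0 // ltW.
have L1 : 0 < Lb + 1 by rewrite ltr_wpDl.
have bL : 0 < b x / 2 / (Lb + 1) by rewrite !divr_gt0.
near=> y.
have d1 : `|y - x| <= 1 by near: y; exact: near_dist_le.
have dL : Lb * `|y - x| <= b x / 2.
  have : `|y - x| <= b x / 2 / (Lb + 1) by near: y; exact: (near_dist_le x bL).
  rewrite ler_pdivlMr // mulrC; apply: le_trans.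
  by rewrite ler_wpM2r // lerDl.
have by1 : `|b y - b x| <= Lb * `|y - x| by near: y.
have by2 : b x / 2 <= b y.
  by move: by1; rewrite ler_norml => /andP[+ _]; lra.
have by0 : 0 < b y by apply: lt_le_trans by2; rewrite divr_gt0.
split=> //.
set D := gvec g y - gvec g x.
have DB : enorm D <= Cg * `|y - x|.
  apply: (le_trans (enorm_le_sum _)).
  rewrite -mulrA mulr_natl -[m in _ *+ m]card_ord -sumr_const; apply: ler_sum => i _.
  rewrite !mxE; move: i; near: y; apply: filter_forall => i; exact: diff_lipschitz.
have D2 : edot D D <= Cg ^+ 2 * `|y - x| ^+ 2.
  by rewrite -(sqr_fnorm hfE) -exprMn lerXn2r ?nnegrE ?sqrtr_ge0 // mulr_ge0.
have sm : (kx / 2 + k2) * Cg ^+ 2 * `|y - x| ^+ 2 <= e * `|y - x|.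
  by near: y; exact: near_sqr_dist_le.
have qD i : g i y <= (q + D) ord0 i.
  have := qvec_ge x mu c i; rewrite -/q !mxE; lra.
have step1 := ineq_term_le mu c0 by0 qD.
have Ek z : 0 < b z -> c / (2 * pfun g psi z mu) = c * N / b z / 2.
  by move=> bz; rewrite /pfun -/b -/N; field; rewrite ?gt_eqF.
have Ekx : c / pfun g psi x mu = kx.
  by rewrite /kx /pfun -/b -/N; field; rewrite ?gt_eqF.
rewrite Ek // in step1; rewrite Ekx {2}/ineq_term -/q Ek // -/kx (sqr_fnorm hfE).
pose ky := c * N / b y; rewrite -/ky in step1.
have kxy : ky - kx <= k2 * `|y - x|.
  have -> : ky - kx = c * N * (b x - b y) / (b x * b y).
    by rewrite /ky /kx; field; rewrite ?gt_eqF.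
  apply: (@le_trans _ _ (c * N * (Lb * `|y - x|) / (b x * (b x / 2)))); last first.
    rewrite le_eqVlt; apply/orP; left; apply/eqP; rewrite /k2; field; rewrite ?gt_eqF //.
  have num : c * N * (b x - b y) <= c * N * (Lb * `|y - x|).
    rewrite ler_pM2l ?mulr_gt0 //; apply: le_trans by1; rewrite distrC; exact: ler_norm.
  apply: (le_trans (ler_wpM2r _ num)); first by rewrite invr_ge0 mulr_ge0 ?(ltW b0) ?(ltW by0).
  apply: ler_wpM2l; first by rewrite !mulr_ge0 ?(ltW c0) ?(ltW N0).
  rewrite lef_pV2 ?posrE ?mulr_gt0 ?divr_gt0 //.
  by rewrite ler_pM2l.
have qD2 : edot (q + D) (q + D) <= 2 * edot q q + 2 * edot D D.
  have := hf_ge0 hfE (q - D); rewrite subE addE; lra.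
have Eq : edot (q + D) (q + D) = edot q q + 2 * edot q D + edot D D.
  exact: addE.
have q0 := hf_ge0 hfE q; have D0 := hf_ge0 hfE D; have qD0 := hf_ge0 hfE (q + D).
have s2 : (ky - kx) / 2 * edot (q + D) (q + D) <= k2 * `|y - x| * (edot q q + edot D D).
  have h1 : (ky - kx) / 2 * edot (q + D) (q + D) <= k2 * `|y - x| / 2 * edot (q + D) (q + D).
    by rewrite ler_wpM2r // ler_pM2r.
  apply: (le_trans h1).
  have -> : k2 * `|y - x| * (edot q q + edot D D) = k2 * `|y - x| / 2 * (2 * edot q q + 2 * edot D D) by field.
  by rewrite ler_wpM2l // divr_ge0 // mulr_ge0.
have s3 : k2 * `|y - x| * edot D D <= k2 * edot D D.
  by rewrite ler_wpM2r // ler_piMr.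
have s4 : (kx / 2 + k2) * edot D D <= e * `|y - x|.
  apply: le_trans sm; rewrite -mulrA; apply: ler_wpM2l => //; apply: addr_ge0 => //.
  by rewrite divr_ge0 // ltW.
have -> : 2 * c * N * Lb * edot q q / b x ^+ 2 = k2 * edot q q.
  by rewrite /k2; ring.
have E1 : edot mu (q + D) + ky / 2 * edot (q + D) (q + D) - (edot mu q + kx / 2 * edot q q)
   = edot mu D + kx * edot q D + kx / 2 * edot D D + (ky - kx) / 2 * edot (q + D) (q + D).
  by rewrite (hfDr hfE q D) mulrBl mulrBl [in kx / 2 * edot (q + D) _]Eq; field.
rewrite (hfDl hfE mu) (hfZl hfE).
have h0 := lerB step1 (lexx (edot mu q + kx / 2 * edot q q)).
rewrite E1 in h0; apply: (le_trans h0).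
move: s2 s3 s4; rewrite !mulrDr !mulrDl; lra.
Unshelve. all: by end_near. Qed.
End Inequality.

Section WeightFunction.
Context {R : realType} {m : nat} (psi : 'rV[R]_m -> R).

Lemma psi_local dpsi : 0 < psi 0 ->
  has_diff_within orthant psi 0 (edot (dpsi 0)) ->
  {within orthant, continuous dpsi} ->
  exists2 d, 0 < d & forall y, orthant y -> `|y| <= d ->
   psi 0 / 2 <= psi y /\ `|dpsi y| <= `|dpsi 0| + 1.
Proof.
have hfE := hilbert_form_edot R m.
have or0 : @orthant R m 0 by move=> i; rewrite mxE.
move=> s0 hd /subspace_continuousP /(_ _ or0) cd.
have s2 : 0 < psi 0 / 2 by rewrite divr_gt0.
have h1 : \forall y \near (0 : 'rV[R]_m), orthant y ->
   `|psi y - psi 0 - edot (dpsi 0) (y - 0)| <= 1 * `|y - 0|.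
  exact: hd ltr01.
have h2 : \forall y \near (0 : 'rV[R]_m), orthant y -> `|dpsi 0 - dpsi y| <= 1.
  by have /cvgrPdist_le /(_ _ ltr01) := cd.
have h3 : \forall y \near (0 : 'rV[R]_m), `|edot y (dpsi 0)| <= psi 0 / 4.
  have /cvgrPdist_le /(_ (psi 0 / 4)) := @hf_continuousl _ _ _ hfE (dpsi 0) 0.
  rewrite divr_gt0 // => /(_ isT); apply: filterS => y.
  by rewrite (hf0l hfE) sub0r normrN.
have h4 : \forall y \near (0 : 'rV[R]_m), `|y - 0| <= psi 0 / 4.
  by apply: near_dist_le; rewrite divr_gt0.
have : \forall y \near (0 : 'rV[R]_m), orthant y ->
    psi 0 / 2 <= psi y /\ `|dpsi y| <= `|dpsi 0| + 1.
  near=> y => oy; split.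
    have g1 : `|psi y - psi 0 - edot (dpsi 0) (y - 0)| <= 1 * `|y - 0| by move: oy; near: y.
    have g3 : `|edot y (dpsi 0)| <= psi 0 / 4 by near: y.
    have g4 : `|y - 0| <= psi 0 / 4 by near: y.
    have {g1} := le_trans g1 (_ : _ <= psi 0 / 4); rewrite mul1r => /(_ g4).
    by move: g3; rewrite subr0 (hf_sym hfE) !ler_norml => /andP[g3 _] /andP[g1 _]; lra.
  have g2 : `|dpsi 0 - dpsi y| <= 1 by move: oy; near: y.
  rewrite -(subrK (dpsi 0) (dpsi y)) addrC; apply: (le_trans (ler_normD _ _)).
  by rewrite lerD2l distrC.
move=> /nbhs_ballP [d /= d0 hd2]; exists (d / 2); first by rewrite divr_gt0.
move=> y oy yd; apply: hd2 => //.
by rewrite -ball_normE /= sub0r normrN; apply: (le_lt_trans yd); move: d0; lra.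
Unshelve. all: by end_near. Qed.
End WeightFunction.

(** * The augmented Lagrangian *)

Section AugmentedLagrangian.
Context {R : realType} {X H : completeNormedModType R} {m : nat}.
Variables (ipX : {dot X for idfun}) (ipH : {dot H for idfun}).
Variables (f : X -> R) (F : X -> H) (g : 'I_m -> X -> R).
Variables (phi : R -> \bar R) (psi : 'rV[R]_m -> R).
Hypotheses (hX : hilbert_dot ipX) (hH : hilbert_dot ipH).
Hypotheses (fD : forall x, differentiable f x) (FD : forall x, differentiable F x).
Hypothesis gD : forall i x, differentiable (g i) x.
Hypotheses (phi_adm : admissible_phi phi) (psi_adm : admissible_psi psi).
Implicit Types (x h : X) (v w : H * 'rV[R]_m).
Let hfX := hilbert_form_dot hX.
Let hfH := hilbert_form_dot hH.
Let hfE := hilbert_form_edot R m.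
Let hpd := @hilbert_form_mult_dot _ _ m _ hH.
Local Notation pd := (@mult_dot R H m ipH).
Local Notation nrm := (fnorm pd).
Local Notation b := (bfun g psi).
Local Notation Sop := (kkt_residual ipX ipH f F g).
Local Notation Qop := (kkt_op ipX ipH F g).
Local Notation Aop := (constraint_map ipX F g).
Local Notation Aadj := (constraint_adj ipX ipH F g).
Local Notation Dop := (@slack_map _ _ H _ g).
Local Notation gradL := (lagr_grad ipX ipH f F g).
Local Notation Om := (Omega F g phi psi).
Local Notation KKT x w := (KKT_point ipX ipH f F g x w.1 w.2).
Local Notation Phi x := (fine (phi (`|F x| ^+ 2))).

(** * Stationarity of the augmented Lagrangian *)

Definition al_value c x w : R :=
  f x + ipH w.1 (F x) + c / 2 * (1 + `|w.1| ^+ 2) * Phi x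
  + ineq_term g psi c w.2 x + 2^-1 * pd (Sop x w) (Sop x w).

Lemma Omega_edom x : Om x -> edom phi (`|F x| ^+ 2).
Proof. by case=> _ h; split=> //; exact: sqr_ge0. Qed.

Lemma Omega_fine x : Om x -> phi (`|F x| ^+ 2) = (Phi x)%:E.
Proof.
by move=> /Omega_edom; exact: fine_phi.
Qed.

Lemma aug_lagrangianE c x w : Om x ->
  aug_lagrangian ipX ipH f F g phi psi x w.1 w.2 c = (al_value c x w)%:E.
Proof.
move=> Ox; rewrite /aug_lagrangian mem_set // (Omega_fine Ox) -EFinM -!EFinD.
by rewrite (etaE _ _ _ _ hH) /al_value /ineq_term; congr EFin; rewrite !addrA.
Qed.

Definition infeasibility c x w : H * 'rV[R]_m := (F x, qvec g psi x w.2 c).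
(** The gradient in (lambda, mu) of everything except eta, with q held fixed. *)
Definition multiplier_gap c x w : H * 'rV[R]_m :=
  infeasibility c x w + (c * Phi x *: w.1, c / b x * enorm (qvec g psi x w.2 c) ^+ 2 *: w.2).

(** Along w + t v, keeping q fixed majorises [al_value] by a quadratic polynomial in t, with
    equality at t = 0. Its linear coefficient <kkt_op S + gap, v> must vanish at a minimiser, for
    every v. *)
Lemma multiplier_stationarity c x w : 0 < c -> 0 < b x ->
  (forall w', al_value c x w <= al_value c x w') -> Qop x (Sop x w) = - multiplier_gap c x w.
Proof.
move=> c0 b0 hmin; apply/eqP; rewrite -addr_eq0; apply/eqP/(hf_eq0r hpd) => v.
rewrite (hfDl hpd) (kkt_op_sym g hX hH FD).
set q := qvec g psi x w.2 c.
apply: (@linear_quadratic_ge0 _ _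
  (c / 2 * Phi x * ipH v.1 v.1 + c / (2 * b x) * edot q q * edot v.2 v.2
   + 2^-1 * pd (Qop x v) (Qop x v))) => t.
have := hmin (t *: v + w); rewrite -subr_ge0 => /le_trans; apply.
have gq i : g i x <= q ord0 i by exact: qvec_ge.
have h1 := ineq_term_le (t *: v.2 + w.2) c0 b0 gq.
have Ep mu : c / (2 * pfun g psi x mu) = c * (1 + edot mu mu) / (2 * b x).
  rewrite /pfun -sqr_enorm; field; rewrite gt_eqF //=.
  by rewrite gt_eqF // ltr_wpDr // sqr_ge0.
have -> : al_value c x w = f x + ipH w.1 (F x) + c / 2 * (1 + ipH w.1 w.1) * Phi x
    + (edot w.2 q + c * (1 + edot w.2 w.2) / (2 * b x) * edot q q)
    + 2^-1 * pd (Sop x w) (Sop x w).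
  by rewrite /al_value -hH /ineq_term -/q Ep sqr_enorm.
have h2 : al_value c x (t *: v + w) <= f x + ipH (t *: v.1 + w.1) (F x)
    + c / 2 * (1 + ipH (t *: v.1 + w.1) (t *: v.1 + w.1)) * Phi x
    + (edot (t *: v.2 + w.2) q
      + c * (1 + edot (t *: v.2 + w.2) (t *: v.2 + w.2)) / (2 * b x) * edot q q)
    + 2^-1 * pd (Sop x w + t *: Qop x v) (Sop x w + t *: Qop x v).
  rewrite /al_value -hH -Ep [t *: v + w]addrC (kkt_residualD hX hH fD FD gD).
  have -> : Qop x (t *: v) = t *: Qop x v.
    have := kkt_op_linear hX hH FD gD x t v 0; rewrite addr0 => ->.
    have := kkt_op_linear hX hH FD gD x 1 0 0; rewrite !scale1r addr0 => /eqP.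
    by rewrite -subr_eq0 opprD addrA subrr sub0r oppr_eq0 => /eqP ->; rewrite addr0.
  rewrite [w + _]addrC; apply: lerD => //; apply: lerD => //.
apply: (le_trans (lerB h2 (lexx _))).
rewrite !(hfDl hfH (t *: v.1), hfDl hfE (t *: v.2), hfDr hfH (t *: v.1), hfDr hfE (t *: v.2)).
rewrite !(hfZl hfH, hfZl hfE, hfZr hfH, hfZr hfE) (hfDl hpd (Sop x w)) !(hfDr hpd (Sop x w)).
rewrite !(hfZl hpd, hfZr hpd) (hf_sym hpd (Qop x v) (Sop x w)) (hf_sym hfH v.1 w.1) (hf_sym hfE v.2 w.2).
rewrite [in leRHS]/multiplier_gap (hfDl hpd (infeasibility c x w)) {1}/infeasibility -/q.
have -> : pd (F x, q) v = ipH v.1 (F x) + edot v.2 q.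
  by rewrite /mult_dot /= (hf_sym hfH) (hf_sym hfE).
have -> : pd (c * Phi x *: w.1, c / b x * enorm q ^+ 2 *: w.2) v =
    c * Phi x * ipH w.1 v.1 + c / b x * edot q q * edot w.2 v.2.
  by rewrite /mult_dot /= (hfZl hfH) (hfZl hfE) sqr_enorm.
by rewrite le_eqVlt; apply/orP; left; apply/eqP; field; rewrite gt_eqF.
Qed.

Lemma multiplier_gap_bound c x w (M : R) : 0 < c -> 0 <= M -> 0 < b x -> (b x)^-1 <= M ->
  0 <= Phi x -> Phi x <= M * `|F x| ^+ 2 -> nrm w <= M ->
  nrm (multiplier_gap c x w) <= nrm (infeasibility c x w) + c * M ^+ 2 * nrm (infeasibility c x w) ^+ 2.
Proof.
move=> c0 M0 b0 bM P0 PM wM.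
apply: (le_trans (fnormD hpd _ _)); rewrite lerD2l.
set q := qvec g psi x w.2 c; set n2 := nrm (infeasibility c x w) ^+ 2.
have En2 : n2 = `|F x| ^+ 2 + enorm q ^+ 2 by rewrite /n2 (sqr_fnorm hpd) /mult_dot hH sqr_enorm.
have h1 : c * Phi x <= c * M * n2.
  rewrite -mulrA ler_pM2l //; apply: (le_trans PM); rewrite ler_wpM2l // En2 lerDl sqr_ge0 //.
have h2 : c / b x * enorm q ^+ 2 <= c * M * n2.
  rewrite -!mulrA ler_pM2l //; apply: ler_pM => //; rewrite ?invr_ge0 ?(ltW b0) ?sqr_ge0 //.
  by rewrite En2 lerDr sqr_ge0.
have n20 : 0 <= c * M * n2 by apply: mulr_ge0; [apply: mulr_ge0 => //; exact: ltW|exact: sqr_ge0].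
have -> : c * M ^+ 2 * n2 = (c * M * n2) * M by ring.
rewrite -(@ler_pXn2r _ 2) ?nnegrE ?fnorm_ge0 ?(mulr_ge0 n20) // (sqr_fnorm hpd) exprMn.
apply: (@le_trans _ _ ((c * M * n2) ^+ 2 * nrm w ^+ 2)); last first.
  by rewrite ler_wpM2l ?sqr_ge0 // lerXn2r ?nnegrE ?fnorm_ge0.
rewrite (sqr_fnorm hpd) /mult_dot /= (hfZl hfH) (hfZr hfH) (hfZl hfE) (hfZr hfE) mulrDr.
have sq (a d : R) : a * (a * d) = a ^+ 2 * d by ring.
rewrite !sq.
have a0 : 0 <= c * Phi x by rewrite mulr_ge0 // ltW.
have a1 : 0 <= c / b x * enorm q ^+ 2 by rewrite mulr_ge0 ?sqr_ge0 // divr_ge0 // ltW.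
by apply: lerD; apply: ler_wpM2r; rewrite ?(hf_ge0 hfH) ?(hf_ge0 hfE) // lerXn2r ?nnegrE.
Qed.

(** By the chain rule, the two penalty terms act on x to first order as a shift of the multipliers
    by these amounts, up to the variation of p. *)
Definition multiplier_step c dphi x w : H * 'rV[R]_m :=
  (c * (1 + `|w.1| ^+ 2) * dphi *: F x, (c / pfun g psi x w.2) *: qvec g psi x w.2 c).

(* Lipschitz bounds at x suffice for b and for eta: their contribution to the
   expansion of al_value is already small enough, being of the order of the
   right-hand side. *)
Lemma primal_stationarity c x w (K M dphi : R) : 0 < c -> 0 <= M -> Om x ->
  bounded_data f F g K x ->
  (b x)^-1 <= M -> nrm w <= M ->
  has_diff_within (edom phi) (fun s => fine (phi s) : R) (`|F x| ^+ 2) (fun t => dphi * t) ->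
  (\forall y \near x, `|b y - b x| <= M * `|y - x|) ->
  (\forall y \near x, nrm (Sop y w - Sop x w) <= M * `|y - x|) ->
  (forall y, Om y -> al_value c x w <= al_value c y w) ->
  `|gradL x (w + multiplier_step c dphi x w)| <=
  2 * (1 + M ^+ 2) * M ^+ 3 * c * nrm (infeasibility c x w) ^+ 2 + nrm (Sop x w) * M.
Proof.
move=> c0 M0 Ox bd bM wM dphiP hb hS hmin.
have b0 : 0 < b x by case: Ox.
set q := qvec g psi x w.2 c; set ms := multiplier_step c dphi x w.
set n2 := nrm (infeasibility c x w) ^+ 2.
have qn2 : enorm q ^+ 2 <= n2.
  by rewrite /n2 (sqr_fnorm hpd) /mult_dot sqr_enorm lerDr (hf_ge0 hfH).
have w2M : enorm w.2 <= M by apply: le_trans wM; exact: le_fnorm_mult_dot2.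
have K0 : 0 <= K by apply: le_trans (jet_val (bd_f bd)).
apply: (norm_le_first_order (x := x) hX).
  by rewrite addr_ge0 ?mulr_ge0 ?addr_ge0 ?fnorm_ge0 ?sqr_ge0 ?exprn_ge0 // ltW.
(* Four remainders share [e]: those of phi, the inequality term, eta and the Lagrangian. The one of
   phi is later multiplied by [l1], whence its tolerance. *)
move=> e e0; have e4 : 0 < e / 4 by rewrite divr_gt0.
pose l1 := c / 2 * (1 + `|w.1| ^+ 2).
have l10 : 0 < l1 by rewrite mulr_gt0 ?divr_gt0 // ltr_wpDr // sqr_ge0.
have phiP := phi_expansion hH phi_adm (FD x) (Omega_edom Ox) dphiP (divr_gt0 e4 l10).
have ineqP := ineq_expansion gD w.2 c0 K0 M0 e4 b0 (fun i => jet_diff (bd_g bd i)) hb.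
have domP := near_edom phi_adm (FD x) (Omega_edom Ox).
have etaP := sqr_expansion hpd M0 e4 hS.
have lagP : \forall y \near x, `|lagrangian ipH f F g y (w + ms).1 (w + ms).2
   - lagrangian ipH f F g x (w + ms).1 (w + ms).2 - ipX (gradL x (w + ms)) (y - x)|
   <= e / 4 * `|y - x|.
  have dL : differentiable (fun y => lagrangian ipH f F g y (w + ms).1 (w + ms).2) x.
    by have [] := is_diff_lagrangian hH fD FD gD x (w + ms).
  have := diff_expansion dL e4; apply: filterS => y.
  by rewrite -(gradE hX _ dL).
near=> y.
have domy : edom phi (`|F y| ^+ 2) by near: y.
have phiy : Phi y - Phi x <= 2 * dphi * ipH (F x) (F y - F x) + e / 4 / l1 * `|y - x| by near: y.
have [by0 ineqy] : 0 < b y /\ ineq_term g psi c w.2 y - ineq_term g psi c w.2 x <=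
      edot (w.2 + (c / pfun g psi x w.2) *: q) (gvec g y - gvec g x)
      + (2 * c * (1 + enorm w.2 ^+ 2) * M * enorm q ^+ 2 / b x ^+ 2 + e / 4) * `|y - x|.
  by near: y.
have etay : 2^-1 * pd (Sop y w) (Sop y w) - 2^-1 * pd (Sop x w) (Sop x w)
   <= (nrm (Sop x w) * M + e / 4) * `|y - x| by near: y.
have lagy : `|lagrangian ipH f F g y (w + ms).1 (w + ms).2
   - lagrangian ipH f F g x (w + ms).1 (w + ms).2 - ipX (gradL x (w + ms)) (y - x)|
   <= e / 4 * `|y - x| by near: y.
have Oy : Om y by split=> //; case: domy.
have := hmin y Oy; rewrite -subr_ge0 => /le_trans; apply.
(* In M^3, one factor is the Lipschitz constant of [b] and two bound 1 / b^2. *)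
have rho2 : 2 * c * (1 + enorm w.2 ^+ 2) * M * enorm q ^+ 2 / b x ^+ 2 <=
   2 * (1 + M ^+ 2) * M ^+ 3 * c * n2.
  have -> : 2 * (1 + M ^+ 2) * M ^+ 3 * c * n2 = 2 * c * (1 + M ^+ 2) * M * n2 * M ^+ 2 by ring.
  have N0 : 0 <= 1 + enorm w.2 ^+ 2 by rewrite addr_ge0 ?sqr_ge0.
  have c0' := ltW c0.
  have A1 : 0 <= 2 * c * (1 + enorm w.2 ^+ 2) * M by do ! apply: mulr_ge0 => //.
  rewrite -exprVn; apply: ler_pM.
  - by rewrite mulr_ge0 // sqr_ge0.
  - by rewrite sqr_ge0.
  - apply: ler_pM; rewrite ?sqr_ge0 //.
    rewrite ler_wpM2r // ler_wpM2l //; first by rewrite mulr_ge0.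
    by rewrite lerD2l lerXn2r ?nnegrE // sqrtr_ge0.
  - by rewrite lerXn2r ?nnegrE // invr_ge0 ltW.
have phi2 : l1 * (Phi y - Phi x) <= c * (1 + `|w.1| ^+ 2) * dphi * ipH (F x) (F y - F x) + e / 4 * `|y - x|.
  apply: (le_trans (ler_wpM2l (ltW l10) phiy)); rewrite le_eqVlt; apply/orP; left; apply/eqP.
  by rewrite /l1; field; rewrite !gt_eqF // ltr_wpDr // sqr_ge0.
(* The first-order parts of all expansions add up to the increment of a single Lagrangian, at the
   shifted multipliers. *)
have lag2 : lagrangian ipH f F g y (w + ms).1 (w + ms).2
   - lagrangian ipH f F g x (w + ms).1 (w + ms).2 =
   f y - f x + (ipH w.1 (F y) - ipH w.1 (F x)) + c * (1 + `|w.1| ^+ 2) * dphi * ipH (F x) (F y - F x)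
   + edot (w.2 + (c / pfun g psi x w.2) *: q) (gvec g y - gvec g x).
  rewrite /lagrangian /= (hfDl hfH w.1) (hfDl hfH w.1) (hfBr hfE) (hfBr hfH).
  by rewrite !(hfZl hfH); ring.
have d0 : 0 <= `|y - x| by [].
have rho3 := ler_wpM2r d0 rho2.
have := le_trans (ler_norm _) lagy; rewrite lag2.
move: phi2 ineqy etay rho3; rewrite /al_value /l1; lra.
Unshelve. all: by end_near. Qed.

(** Two cases for each i. If q_i = -(p / c) mu_i, the shift cancels mu_i exactly. Otherwise q_i =
    g_i, and the factor g_i^2 of the slack operator is itself quadratic in the infeasibility. *)
Lemma slack_map_bound c x w (M dphi : R) : 0 < c -> 0 <= M -> 0 < b x -> (b x)^-1 <= M ->
  nrm w <= M ->
  nrm (Dop x (w + multiplier_step c dphi x w)) <=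
  nrm (infeasibility c x w) ^+ 2 * (M + c * (1 + M ^+ 2) * M * nrm (infeasibility c x w)).
Proof.
move=> c0 M0 b0 bM wM; set n := nrm (infeasibility c x w); set q := qvec g psi x w.2 c.
have w2M : enorm w.2 <= M by apply: le_trans wM; exact: le_fnorm_mult_dot2.
have n0 : 0 <= n by exact: fnorm_ge0.
have p0 : 0 < pfun g psi x w.2 by exact: pfun_gt0.
have qn : enorm q <= n by exact: (le_fnorm_mult_dot2 hH (infeasibility c x w)).
have cp : c / pfun g psi x w.2 <= c * (1 + M ^+ 2) * M.
  rewrite /pfun invf_div mulrA; apply: ler_pM => //.
  - by rewrite mulr_ge0 ?addr_ge0 ?sqr_ge0 // ltW.
  - by rewrite invr_ge0 ltW.
  - by rewrite ler_pM2l // lerD2l lerXn2r ?nnegrE // sqrtr_ge0.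
have B0 : 0 <= M + c * (1 + M ^+ 2) * M * n.
  by rewrite addr_ge0 // mulr_ge0 // mulr_ge0 // mulr_ge0 ?(ltW c0) // addr_ge0 ?sqr_ge0.
apply: (@le_trans _ _ (enorm q ^+ 2 * (M + c * (1 + M ^+ 2) * M * n))); last first.
  by rewrite ler_wpM2r // lerXn2r ?nnegrE ?sqrtr_ge0.
apply: (le_trans (fnorm_mult_dot_le hH _)); rewrite /= normr0 add0r sqr_enorm /edot mulr_suml.
apply: ler_sum => i _; rewrite !mxE normrM ger0_norm ?sqr_ge0 // -expr2.
rewrite -/(pfun g psi x w.2); set qi := Num.max _ _.
have qiE : q ord0 i = qi by rewrite !mxE.
have qin : `|qi| <= n by rewrite -qiE; exact: le_trans (le_enorm _ _) qn.
have muM : `|w.2 ord0 i| <= M by exact: le_trans (le_enorm _ _) w2M.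
have [gq|] := leP (g i x) (- (c^-1 * pfun g psi x w.2) * w.2 ord0 i).
  have -> : qi = - (c^-1 * pfun g psi x w.2) * w.2 ord0 i by rewrite /qi; apply/max_idPr.
  have -> : forall p mu : R, 0 < p -> mu + c / p * (- (c^-1 * p) * mu) = 0.
  - by move=> p mu pp; field; rewrite !gt_eqF.
  - by rewrite normr0 mulr0 mulr_ge0 // sqr_ge0.
  - exact: p0.
move=> gq; have gqi : qi = g i x by rewrite /qi; apply/max_idPl/ltW.
rewrite gqi ler_wpM2l ?sqr_ge0 //; apply: (le_trans (ler_normD _ _)); apply: lerD => //.
have cp0 : 0 < c / pfun g psi x w.2 := divr_gt0 c0 p0.
rewrite normrM (gtr0_norm cp0); apply: ler_pM => //; first exact: ltW.
by rewrite -gqi.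
Qed.

Lemma stationary_residual (M : R) : 1 <= M -> exists2 C0, 0 < C0 &
  forall c x w (K dphi : R), C0 <= c -> Om x ->
  bounded_data f F g K x ->
  (forall h, nrm (Aop x h) <= M * `|h|) ->
  (b x)^-1 <= M -> b x <= M -> nrm w <= M -> M^-1 <= dphi ->
  has_diff_within (edom phi) (fun s => fine (phi s) : R) (`|F x| ^+ 2) (fun t => dphi * t) ->
  Phi x <= M * `|F x| ^+ 2 ->
  (\forall y \near x, `|b y - b x| <= M * `|y - x|) ->
  (\forall y \near x, nrm (Sop y w - Sop x w) <= M * `|y - x|) ->
  (forall v, nrm v <= M * nrm (Qop x v)) ->
  c * nrm (infeasibility c x w) ^+ 2 <= M ^+ 2 ->
  (forall y w', Om y -> al_value c x w <= al_value c y w') ->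
  infeasibility c x w = 0 /\ gradL x w = 0.
Proof.
move=> M1.
have M0 : 0 < M by exact: lt_le_trans M1.
have M0' := ltW M0.
(* In units of N = sqrt c n, [C1] bounds S, [C2] the gradient at the shifted multipliers, and [C3]
   the image of the shift under [kkt_op], with one summand for each term of [Qms]. *)
pose C1 := M * (1 + M ^+ 3).
pose C2 := 2 * (1 + M ^+ 2) * M ^+ 4 + C1 * M.
pose C3 := M * C2 + C1 + (M ^+ 2 + (1 + M ^+ 2) * M ^+ 3).
have MX k : 0 <= M ^+ k by rewrite exprn_ge0.
have C10 : 0 <= C1 by apply: mulr_ge0 => //; apply: addr_ge0.
have C20 : 0 <= C2.
  by apply: addr_ge0; apply: mulr_ge0 => //; apply: mulr_ge0 => //; apply: addr_ge0.
have C30 : 0 <= C3.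
  apply: addr_ge0; first by apply: addr_ge0 => //; apply: mulr_ge0.
  by apply: addr_ge0 => //; apply: mulr_ge0 => //; apply: addr_ge0.
(* The final inequality is sqrt c N <= M^2 C3 N, so sqrt c >= M^2 C3 + 1 leaves only N = 0. *)
exists ((M ^+ 2 * C3 + 1) ^+ 2).
  by rewrite exprn_gt0 // ltr_wpDl // mulr_ge0.
move=> c x w K dphi Cc Ox bd AM bM Mb wM dM dphiP PM hb hS QM cn hmin.
have b0 : 0 < b x by case: Ox.
have C4 : 1 <= M ^+ 2 * C3 + 1 by rewrite lerDr mulr_ge0.
have c1 : 1 <= c by apply: le_trans Cc; rewrite -[leLHS](expr1n _ 2) lerXn2r ?nnegrE // (le_trans ler01).
have c0 : 0 < c by exact: lt_le_trans c1.
pose s := Num.sqrt c.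
have s2 : s ^+ 2 = c by rewrite sqr_sqrtr // ltW.
have sC : M ^+ 2 * C3 + 1 <= s.
  by rewrite -(@ler_pXn2r _ 2) ?nnegrE ?sqrtr_ge0 ?s2 // addr_ge0 // mulr_ge0.
have s1 : 1 <= s by exact: le_trans sC.
have s0 : 0 < s by exact: lt_le_trans s1.
set n := nrm (infeasibility c x w) in cn.
have n0 : 0 <= n by exact: fnorm_ge0.
pose N := s * n.
have N0 : 0 <= N by rewrite mulr_ge0 // ltW.
have NM : N <= M.
  by rewrite -(@ler_pXn2r _ 2) ?nnegrE // exprMn s2.
have nN : n <= N by rewrite ler_peMl.
have cn2 : c * n ^+ 2 <= M * N by rewrite -s2 -exprMn expr2 ler_wpM2r.
have n2 : n ^+ 2 <= M * N.
  by apply: le_trans cn2; rewrite ler_peMl // sqr_ge0.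
have cn3 : c * n ^+ 3 <= M ^+ 2 * N.
  rewrite exprS mulrCA mulrC.
  by apply: ler_pM => //; rewrite mulr_ge0 ?sqr_ge0 // ltW.
have Phi0 : 0 <= Phi x.
  by apply: fine_ge0; apply: (phi_ge0 phi_adm); exact: sqr_ge0.
have QS := multiplier_stationarity c0 b0 (fun w' => hmin x w' Ox).
have RN : nrm (multiplier_gap c x w) <= (1 + M ^+ 3) * N.
  apply: (le_trans (multiplier_gap_bound c0 M0' b0 bM Phi0 PM wM)); rewrite -/n mulrDl mul1r.
  apply: lerD => //.
  have -> : c * M ^+ 2 * n ^+ 2 = M ^+ 2 * (c * n ^+ 2) by ring.
  have -> : M ^+ 3 * N = M ^+ 2 * (M * N) by ring.
  by rewrite ler_wpM2l.
have SN : nrm (Sop x w) <= C1 * N.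
  apply: (le_trans (QM _)); rewrite QS (fnormN hpd) /C1 -mulrA ler_wpM2l //.
have vN := primal_stationarity c0 M0' Ox bd bM wM dphiP hb hS (fun y => hmin y w).
set ms := multiplier_step c dphi x w in vN.
have {}vN : `|gradL x (w + ms)| <= C2 * N.
  apply: (le_trans vN); rewrite -/n (mulrDl (2 * (1 + M ^+ 2) * M ^+ 4)); apply: lerD.
    have -> : 2 * (1 + M ^+ 2) * M ^+ 3 * c * n ^+ 2 = 2 * (1 + M ^+ 2) * M ^+ 3 * (c * n ^+ 2) by ring.
    have -> : 2 * (1 + M ^+ 2) * M ^+ 4 * N = 2 * (1 + M ^+ 2) * M ^+ 3 * (M * N) by ring.
    by rewrite ler_wpM2l // mulr_ge0 // mulr_ge0 // addr_ge0.
  by rewrite mulrAC ler_wpM2r.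
have DN : nrm (Dop x (w + ms)) <= (M ^+ 2 + (1 + M ^+ 2) * M ^+ 3) * N.
  apply: (le_trans (slack_map_bound dphi c0 M0' b0 bM wM)); rewrite -/n.
  have -> : n ^+ 2 * (M + c * (1 + M ^+ 2) * M * n)
    = M * n ^+ 2 + (1 + M ^+ 2) * M * (c * n ^+ 3) by ring.
  have -> : (M ^+ 2 + (1 + M ^+ 2) * M ^+ 3) * N
    = M * (M * N) + (1 + M ^+ 2) * M * (M ^+ 2 * N) by ring.
  by apply: lerD; rewrite ler_wpM2l // mulr_ge0 // addr_ge0.
have Qms : Qop x ms = Aop x (gradL x (w + ms)) - Sop x w + Dop x (w + ms).
  have -> : gradL x (w + ms) = gradL x w + Aadj x ms.
    by rewrite !(lagr_grad_decomp hX hH fD FD gD) (constraint_adjD g hX hH FD) addrA.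
  rewrite (constraint_mapD F hX gD x _ (Aadj x ms)) (slack_mapD g) /kkt_residual /kkt_op opprD !addrA.
  by rewrite [Aop x _ + Aop x _]addrC addrK -!addrA addKr.
have QN : nrm (Qop x ms) <= C3 * N.
  rewrite Qms; apply: (le_trans (fnormD hpd _ _)); rewrite /C3 mulrDl; apply: lerD => //.
  apply: (le_trans (fnormB hpd _ _)); rewrite mulrDl; apply: lerD => //.
  by apply: (le_trans (AM _)); rewrite -mulrA ler_wpM2l.
(* Both coefficients of the shift are at least c / M: the first by the lower bound on the slope of
   phi, the second because p <= b <= M. *)
have msn : c * n <= M * nrm ms.
  have p0 : 0 < pfun g psi x w.2 by exact: pfun_gt0.
  have pM : pfun g psi x w.2 <= M.
    rewrite ler_pdivrMr; last by rewrite ltr_wpDr // sqr_ge0.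
    by apply: (le_trans Mb); rewrite ler_peMr // lerDl sqr_ge0.
  have k1 : c <= M * (c * (1 + `|w.1| ^+ 2) * dphi).
    have -> : M * (c * (1 + `|w.1| ^+ 2) * dphi) = c * ((1 + `|w.1| ^+ 2) * (M * dphi)) by ring.
    rewrite ler_peMr ?(ltW c0) // -[leLHS]mulr1; apply: ler_pM => //; first by rewrite lerDl sqr_ge0.
    by rewrite mulrC -ler_pdivrMr // mul1r.
  have k2 : c <= M * (c / pfun g psi x w.2).
    by rewrite mulrCA ler_peMr ?(ltW c0) // ler_pdivlMr // mul1r.
  rewrite -(@ler_pXn2r _ 2) ?nnegrE ?mulr_ge0 ?fnorm_ge0 // ?(ltW c0) //.
  rewrite !exprMn /n !(sqr_fnorm hpd) /mult_dot /=.
  rewrite (hfZl hfH) (hfZr hfH) (hfZl hfE) (hfZr hfE) (mulrDr (c ^+ 2)) (mulrDr (M ^+ 2)).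
  have sq (a t : R) : M ^+ 2 * (a * (a * t)) = (M * a) ^+ 2 * t by ring.
  rewrite !sq; apply: lerD; apply: ler_wpM2r; rewrite ?(hf_ge0 hfH) ?(hf_ge0 hfE) //.
    by rewrite lerXn2r ?nnegrE ?(ltW c0) //; exact: (le_trans (ltW c0) k1).
  by rewrite lerXn2r ?nnegrE ?(ltW c0) //; exact: (le_trans (ltW c0) k2).
have n00 : n = 0.
  have h : s * N <= M ^+ 2 * C3 * N.
    rewrite mulrA -expr2 s2; apply: (le_trans msn); rewrite expr2 -!mulrA ler_wpM2l //.
    by apply: (le_trans (QM _)); rewrite ler_wpM2l.
  have N00 : N <= 0.
    have : (M ^+ 2 * C3 + 1) * N <= s * N by rewrite ler_wpM2r.
    by move: h; rewrite mulrDl mul1r; lra.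
  by apply/eqP; rewrite eq_le n0 andbT; exact: le_trans N00.
have FQ0 : infeasibility c x w = 0 by exact: (fnorm_eq0 hpd).
have N00 : N = 0 by rewrite /N n00 mulr0.
split=> //.
have ms0 : ms = 0.
  by case: FQ0 => F0 q0; rewrite /ms /multiplier_step F0 q0 !scaler0.
by apply/eqP; move: vN; rewrite ms0 addr0 N00 mulr0 normr_le0.
Qed.

(** * Optimal values and KKT points *)

Lemma optimal_valueE x : globally_optimal f F g x -> optimal_value f F g = f x.
Proof.
move=> [fx hx]; apply/eqP; rewrite eq_le; apply/andP; split.
  apply: ge_inf; last by exists x.
  by exists (f x) => _ [y fy <-]; exact: hx.
apply: lb_le_inf; first by exists (f x), x.
by move=> _ [y fy <-]; exact: hx.
Qed.

Lemma feasible_Omega x : feasible F g x -> Om x.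
Proof.
move=> [Fx gx]; split.
  rewrite /bfun (_ : vmax _ _ = 0); first exact: psi0_gt0 psi_adm.
  by apply/rowP => i; rewrite !mxE; apply/max_idPr.
by rewrite Fx normr0 expr0n /= (phi0 phi_adm).
Qed.

Lemma KKT_feasible x w : KKT x w -> feasible F g x.
Proof.
move=> [_ F0 /rowP h]; split=> // i.
by have := h i; rewrite !mxE => <-; rewrite le_max lexx.
Qed.

(** The hypothesis encodes complementarity, a <= 0 <= t and a t = 0, which ignores positive
    rescaling of t. This passes between q = 0, where mu carries the factor p / c, and the KKT
    condition. *)
Lemma max_eq0_scale (a t k : R) : 0 < k -> Num.max a (- t) = 0 -> Num.max a (- k * t) = 0.
Proof.
move=> k0; have [at_|ta] := leP a (- t).
  move=> t0; have -> : t = 0 by lra.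
  by rewrite mulr0; apply/max_idPr; rewrite -t0.
move=> a0; rewrite a0; apply/max_idPl; move: ta; rewrite a0 oppr_lt0 => t0.
by rewrite mulNr oppr_le0 mulr_ge0 // ltW.
Qed.

Lemma KKT_of_residual c x w : 0 < c -> 0 < b x -> infeasibility c x w = 0 -> gradL x w = 0 -> KKT x w.
Proof.
move=> c0 b0 [F0 /rowP q0] L0; split=> //; apply/rowP => i.
have p0 : 0 < pfun g psi x w.2 by exact: pfun_gt0.
have k0 : 0 < (c^-1 * pfun g psi x w.2)^-1 by rewrite invr_gt0 mulr_gt0 // invr_gt0.
have := q0 i; rewrite !mxE mulNr => /(max_eq0_scale k0).
by rewrite mulNr mulKf // gt_eqF // mulr_gt0 // invr_gt0.
Qed.

Lemma al_value_KKT c x w : 0 < c -> KKT x w -> al_value c x w = f x.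
Proof.
move=> c0 hK; have [L0 F0 /rowP h] := hK.
have Ox := feasible_Omega (KKT_feasible hK); have [b0 _] := Ox.
have p0 : 0 < pfun g psi x w.2 by exact: pfun_gt0.
have q0 : qvec g psi x w.2 c = 0.
  apply/rowP => i; rewrite !mxE.
  have := h i; rewrite !mxE => /max_eq0_scale; apply.
  by apply: mulr_gt0 => //; rewrite invr_gt0.
have S0 : Sop x w = 0.
  rewrite /kkt_residual /lagr_grad L0 /constraint_map /slack_map; apply/pair_equal_spec; split => /=.
    by rewrite linear0 addr0.
  apply/rowP => i; rewrite !mxE (hf0r hfX) add0r.
  have := h i; rewrite !mxE; have [_ t0|_ ->] := leP; last by rewrite expr0n mul0r.
  have -> : w.2 ord0 i = 0 by lra.
  by rewrite mulr0.
by rewrite /al_value /ineq_term q0 S0 sqr_enorm (hf0l hpd) (hf0r hfE) F0 (hf0r hfH) normr0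
  expr0n /= (phi0 phi_adm) /= (hf0l hfE) !mulr0 !addr0.
Qed.

(** * Lower bound and existence of minimisers *)

Lemma sqr_norm_infeasibility c x w : nrm (infeasibility c x w) ^+ 2 = `|F x| ^+ 2 + enorm (qvec g psi x w.2 c) ^+ 2.
Proof. by rewrite (sqr_fnorm hpd) /mult_dot hH sqr_enorm. Qed.

Lemma vmax_le_qvec c x (mu : 'rV[R]_m) :
  enorm (vmax (gvec g x) 0) ^+ 2 <= enorm (qvec g psi x mu c) ^+ 2.
Proof.
rewrite !sqr_enorm; apply: ler_sum => i _; rewrite -!expr2.
have gq := qvec_ge g psi x mu c i; rewrite [in leLHS]mxE mxE [X in Num.max _ X]mxE.
have [g0|g0] := leP (g i x) 0; first by rewrite expr0n sqr_ge0.
by rewrite lerXn2r // ?nnegrE ?(ltW g0) // (le_trans (ltW g0)).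
Qed.

Lemma linear_quadratic_lower (y a : R) : 0 < a -> - (4 * a)^-1 <= - y + a * y ^+ 2.
Proof.
move=> a0; rewrite -subr_ge0.
have -> : - y + a * y ^+ 2 - - (4 * a)^-1 = a * (y - (2 * a)^-1) ^+ 2.
  by field; rewrite gt_eqF.
by rewrite mulr_ge0 ?sqr_ge0 // ltW.
Qed.

Lemma al_value_lower sigma : 0 < sigma ->
  (forall t, edom phi t -> sigma * t <= fine (phi t)) ->
  exists kC : R * R, [/\ 0 < kC.1, 0 < kC.2 & forall c x w, 0 < c -> Om x ->
    f x + c * kC.1 * nrm (infeasibility c x w) ^+ 2 + 2^-1 * nrm (Sop x w) ^+ 2 - kC.2 / c
    <= al_value c x w].
Proof.
move=> s0 hphi.
have psi0 := psi0_gt0 psi_adm.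
(* The parts of the penalties weighted by |lambda|^2 and |mu|^2 absorb the pairings by completing
   squares, with a = c sigma / 4 and a = c / (4 psi(0)). The losses 1 / (4 a) add up to the second
   constant over c; the unweighted parts yield the first. *)
exists (Num.min (sigma / 4) (4 * psi 0)^-1, sigma^-1 + psi 0) => /=; split.
- by rewrite lt_min divr_gt0 //= invr_gt0 mulr_gt0.
- by rewrite addr_gt0 // invr_gt0.
move=> c x w c0 Ox; have [b0 _] := Ox.
set k := Num.min _ _.
have k1 : k <= sigma / 4 by rewrite ge_min lexx.
have k2 : k <= (4 * psi 0)^-1 by rewrite ge_min lexx orbT.
have bpsi : b x <= psi 0 by apply: (psi_max0 psi_adm); exact: vmax0_orthant.
have Phil := hphi _ (Omega_edom Ox).
set q := qvec g psi x w.2 c; rewrite sqr_norm_infeasibility -/q (sqr_fnorm hpd) /al_value.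
have F2 : 0 <= `|F x| ^+ 2 by exact: sqr_ge0.
have l2 : 0 <= `|w.1| ^+ 2 by exact: sqr_ge0.
have q2 : 0 <= enorm q ^+ 2 by exact: sqr_ge0.
have m2 : 0 <= enorm w.2 ^+ 2 by exact: sqr_ge0.
have h1 : c * k * `|F x| ^+ 2 - (sigma * c)^-1 <=
    ipH w.1 (F x) + c / 2 * (1 + `|w.1| ^+ 2) * Phi x.
  have cs : - (`|w.1| * `|F x|) <= ipH w.1 (F x).
    have := hf_CS hfH w.1 (F x); rewrite !(fnorm_dot hH) ler_norml => /andP[] //.
  have a0 : 0 < c * sigma / 4 by rewrite divr_gt0 // mulr_gt0.
  have := linear_quadratic_lower (`|w.1| * `|F x|) a0.
  have -> : (4 * (c * sigma / 4))^-1 = (sigma * c)^-1.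
    by congr (_^-1); field.
  have A1 : c / 2 * (1 + `|w.1| ^+ 2) * (sigma * `|F x| ^+ 2) <=
      c / 2 * (1 + `|w.1| ^+ 2) * Phi x.
    by rewrite ler_wpM2l // mulr_ge0 ?divr_ge0 ?(ltW c0) // addr_ge0.
  have A2 : c * k * `|F x| ^+ 2 <= c * (sigma / 4) * `|F x| ^+ 2.
    by rewrite ler_wpM2r // ler_pM2l.
  have A3 : 0 <= c * sigma * `|F x| ^+ 2 by rewrite !mulr_ge0 // ltW.
  have A4 : 0 <= c * sigma * (`|w.1| ^+ 2 * `|F x| ^+ 2) by rewrite !mulr_ge0 // ltW.
  by rewrite exprMn; move: cs A1 A2 A3 A4; lra.
have h2 : c * k * enorm q ^+ 2 - psi 0 / c <= ineq_term g psi c w.2 x.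
  rewrite /ineq_term -/q.
  have cs : - (enorm w.2 * enorm q) <= edot w.2 q.
    have := hf_CS hfE w.2 q; rewrite ler_norml => /andP[] //.
  have pE : c / (2 * pfun g psi x w.2) = c * (1 + enorm w.2 ^+ 2) / (2 * b x).
    rewrite /pfun; field; rewrite gt_eqF //=.
    by rewrite gt_eqF // ltr_wpDr.
  have ip : (psi 0)^-1 <= (b x)^-1 by rewrite lef_pV2 ?posrE.
  have A1 : c * (1 + enorm w.2 ^+ 2) / 2 * enorm q ^+ 2 * (psi 0)^-1 <=
      c / (2 * pfun g psi x w.2) * enorm q ^+ 2.
    rewrite pE invfM.
    have -> : c * (1 + enorm w.2 ^+ 2) * (2^-1 / b x) * enorm q ^+ 2 =
      c * (1 + enorm w.2 ^+ 2) / 2 * enorm q ^+ 2 / b x by ring.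
    apply: ler_wpM2l => //; apply: mulr_ge0 => //; apply: mulr_ge0 => //.
    by apply: mulr_ge0; rewrite ?(ltW c0) // addr_ge0.
  have a0 : 0 < c / (4 * psi 0) by rewrite divr_gt0 // mulr_gt0.
  have := linear_quadratic_lower (enorm w.2 * enorm q) a0.
  have -> : (4 * (c / (4 * psi 0)))^-1 = psi 0 / c.
    by field; rewrite !gt_eqF.
  have A2 : c * k * enorm q ^+ 2 <= c * (4 * psi 0)^-1 * enorm q ^+ 2.
    by rewrite ler_wpM2r // ler_pM2l.
  have A3 : 0 <= c * (psi 0)^-1 * enorm q ^+ 2.
    by apply: mulr_ge0 => //; apply: mulr_ge0; rewrite ?invr_ge0 ltW.
  have A4 : 0 <= c * (psi 0)^-1 * (enorm w.2 ^+ 2 * enorm q ^+ 2).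
    by apply: mulr_ge0; apply: mulr_ge0; rewrite // ?invr_ge0 ltW.
  by rewrite exprMn; move: cs A1 A2 A3 A4; rewrite !invfM; lra.
have -> : (sigma^-1 + psi 0) / c = (sigma * c)^-1 + psi 0 / c.
  by rewrite invfM mulrDl.
by move: h1 h2; lra.
Qed.

(** Direct method. [Omega] need not be weakly closed: semicontinuity concerns the extended value,
    infinite outside [Omega], so a weak limit of finite value lies in [Omega]. *)
Lemma exists_minimiser c (lev B lo : R) :
  weakly_seq_lsc ipX ipH (fun z =>
       aug_lagrangian ipX ipH f F g phi psi z.1.1 z.1.2 z.2 c) ->
  (exists x w, Om x /\ al_value c x w <= lev) ->
  (forall x w, Om x -> al_value c x w <= lev -> [/\ `|x| <= B, nrm w <= B & lo <= al_value c x w]) ->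
  exists x w, [/\ Om x, al_value c x w <= lev & forall y w', Om y -> al_value c x w <= al_value c y w'].
Proof.
move=> wlsc [x0 [w0 [Ox0 Al0]]] bnd.
pose V := [set r : R | exists x w, [/\ Om x, al_value c x w <= lev & r = al_value c x w]].
have Vinf : has_inf V.
  split; first by exists (al_value c x0 w0), x0, w0.
  by exists lo => _ [x [w [Ox Aw ->]]]; have [] := bnd x w Ox Aw.
have pick n : exists z : X * H * 'rV[R]_m, [/\ Om z.1.1, al_value c z.1.1 (z.1.2, z.2) <= lev &
    al_value c z.1.1 (z.1.2, z.2) < inf V + n.+1%:R^-1].
  have [|_ [x [[l mu] [Ox Aw ->]]] h] := inf_adherent (eps := n.+1%:R^-1) _ Vinf.
    by rewrite invr_gt0.
  by exists (x, l, mu).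
have {pick} [z hz] := choice pick.
have zB n : `|z n| <= B.
  have [Oz Az _] := hz n; have [xB wB _] := bnd _ _ Oz Az.
  have B0 : 0 <= B by exact: le_trans xB.
  rewrite !prod_normE !ge_max xB /=; apply/andP; split.
    by apply: le_trans wB; exact: (le_fnorm_mult_dot1 hH (_, _)).
  apply: norm_le_coord => // i; apply: le_trans wB.
  exact: le_trans (le_enorm _ _) (le_fnorm_mult_dot2 hH (_, _)).
have hfZ : hilbert_form (prod_dot ipX ipH (m := m)).
  exact: hilbert_form_prod (hilbert_form_prod hfX hfH) hfE.
have [p [s [sk wk]]] := weak_sequential_compactness hfZ zB.
pose u k := al_value c (z (s k)).1.1 ((z (s k)).1.2, (z (s k)).2).
have := wlsc (fun k => z (s k)) p wk.
have uE : (fun k => (u k)%:E) = (fun z : X * H * 'rV[R]_m =>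
   aug_lagrangian ipX ipH f F g phi psi z.1.1 z.1.2 z.2 c) \o (fun k => z (s k)).
  apply/funext => k /=; have [Oz _ _] := hz (s k).
  by rewrite -(aug_lagrangianE c (_, _) Oz).
have cu : u k @[k --> \oo] --> inf V.
  apply/cvgrPdist_le => e e0.
  have [N _ hN] := near_infty_natSinv_lt (PosNum e0).
  exists N => // k /= Nk; have [Oz Az uk] := hz (s k).
  have lu : inf V <= u k by apply: ge_inf; [exact: Vinf.2|exists (z (s k)).1.1, ((z (s k)).1.2, (z (s k)).2)].
  rewrite ler0_norm ?subr_le0 // opprB lerBlDl.
  apply: ltW; apply: (lt_trans uk); rewrite ltrD2l; apply: hN => /=.
  exact: leq_trans Nk (sk k).
have cue : (u k)%:E @[k --> \oo] --> (inf V)%:E.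
  by apply: cvg_EFin => //; exact: nearW.
rewrite -uE is_cvg_limn_einfE; last by apply/cvg_ex; exists (inf V)%:E.
rewrite (cvg_lim _ cue) // => Ep.
have Op : Om p.1.1.
  by move: Ep; rewrite /aug_lagrangian; case: ifPn => [/set_mem//|_]; rewrite leye_eq.
rewrite (aug_lagrangianE c (p.1.2, p.2) Op) lee_fin in Ep.
have Vlev : inf V <= lev.
  by apply: (le_trans _ Al0); apply: ge_inf; [exact: Vinf.2|exists x0, w0].
exists p.1.1, (p.1.2, p.2); split=> //; first exact: le_trans Vlev.
move=> y w' Oy; have [yl|yl] := leP (al_value c y w') lev; last first.
  by apply: le_trans (ltW yl); exact: le_trans Vlev.
by apply: (le_trans Ep); apply: ge_inf; [exact: Vinf.2|exists y, w'].
Qed.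
End AugmentedLagrangian.

(** * Global exactness *)

Theorem theorem5p3 (R : realType) (X H : completeNormedModType R)
  (ipX : {dot X for idfun}) (ipH : {dot H for idfun}) (m : nat)
  (f : X -> R) (F : X -> H) (g : 'I_m -> X -> R)
  (phi : R -> \bar R) (psi : 'rV[R]_m -> R)
  (ipX_norm : hilbert_dot ipX) (ipH_norm : hilbert_dot ipH)
  (f_C1 : C1 f) (F_C1 : C1 F) (g_C1 : forall i, C1 (g i))
  (phi_adm : admissible_phi phi) (psi_adm : admissible_psi psi)
  (opt_ex : exists x, globally_optimal f F g x)
  (opt_KKT : forall x, globally_optimal f F g x ->
     exists lam mu, KKT_point ipX ipH f F g x lam mu)
  (f_C2 : C2_on (Omega F g phi psi) f)
  (F_C2 : C2_on (Omega F g phi psi) F)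
  (g_C2 : forall i, C2_on (Omega F g phi psi) (g i))
  (phi_smooth : phi_C1 phi)
  (AL_wlsc : forall c : R, 0 < c ->
     weakly_seq_lsc ipX ipH (fun z =>
       aug_lagrangian ipX ipH f F g phi psi z.1.1 z.1.2 z.2 c))
  (r eps : R) (r_gt0 : 0 < r) (eps_gt0 : 0 < eps)
  (level_bounded :
     bounded_set (Omega_r f F g phi psi r (optimal_value f F g + eps)))
  (f_bounded :
     bounded_C2_on (Omega_r f F g phi psi r (optimal_value f F g + eps)) f)
  (F_bounded :
     bounded_C2_on (Omega_r f F g phi psi r (optimal_value f F g + eps)) F)
  (g_bounded : forall i,
     bounded_C2_on (Omega_r f F g phi psi r (optimal_value f F g + eps)) (g i))
  (Q_coercive : exists2 a : R, 0 < a &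
     forall x, Omega_r f F g phi psi r (optimal_value f F g + eps) x ->
     forall lam mu,
       a * (`|lam| ^+ 2 + enorm mu ^+ 2) <= Qform ipX ipH F g x lam mu) :
  globally_exact ipX ipH f F g phi psi.
Proof.
have fD := f_C1.1; have FD := F_C1.1; have gD i := (g_C1 i).1.
have hpd := @hilbert_form_mult_dot _ _ m _ ipH_norm.
set fs := optimal_value f F g in level_bounded f_bounded F_bounded g_bounded Q_coercive.
set Or := Omega_r f F g phi psi r (fs + eps) in level_bounded f_bounded F_bounded g_bounded Q_coercive.
set Om := Omega F g phi psi in f_C2 F_C2 g_C2.
pose nrm := fnorm (@mult_dot R H m ipH).
pose L c x w := al_value ipX ipH f F g phi psi c x w.
have OrOm x : Or x -> Om x by case.
have [K K0 dataK] : exists2 K, 0 <= K & forall x, Or x -> bounded_data f F g K x.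
  have [K1 K10 h1] := uniform_bounded_jet f_bounded (fun x Ox => f_C2.1 x (OrOm x Ox)).
  have [K2 K20 h2] := uniform_bounded_jet F_bounded (fun x Ox => F_C2.1 x (OrOm x Ox)).
  have /choice [K3 h3] : forall i, exists K, 0 <= K /\ forall x, Or x -> bounded_jet K (g i) x.
    move=> i; have [K3 K30 h3] := uniform_bounded_jet (g_bounded i) (fun x Ox => (g_C2 i).1 x (OrOm x Ox)).
    by exists K3.
  have K30 : 0 <= \sum_i K3 i by apply: sumr_ge0 => i _; exact: (h3 i).1.
  exists (K1 + K2 + \sum_i K3 i); first by rewrite !addr_ge0.
  move=> x Ox; split.
  - by apply: bounded_jet_mono (h1 x Ox); rewrite -addrA lerDl addr_ge0.
  - by apply: bounded_jet_mono (h2 x Ox); rewrite addrAC lerDr addr_ge0.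
  - move=> i; apply: bounded_jet_mono ((h3 i).2 x Ox).
    rewrite (bigD1 i) //= addrCA lerDl !addr_ge0 // sumr_ge0 // => j _; exact: (h3 j).1.
have [dphi [hdphi cdphi dphi0]] := phi_smooth.
have hd0 := hdphi 0 (edom0 phi_adm).
have sig0 : 0 < dphi 0 / 2 by rewrite divr_gt0.
have [[k C] /= [k0 C0 lowL]] := al_value_lower ipX f F g ipH_norm psi_adm sig0 (phi_lower phi_adm dphi0 hd0).
have [d1 d10 hd1] := phi_local phi_adm dphi0 hd0 cdphi.
have psi0 := psi0_gt0 psi_adm.
have [dpsi [hdpsi cdpsi]] := psi_C1 psi_adm.
have or0 : @orthant R m 0 by move=> i; rewrite mxE.
have [d2 d20 hd2] := psi_local psi0 (hdpsi 0 or0) cdpsi.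
have [a a0 hQ] := Q_coercive.
have [xs opts] := opt_ex; have [ls [ms KKTs]] := opt_KKT _ opts.
have fsE : fs = f xs := optimal_valueE opts.
have Os : Om xs := feasible_Omega phi_adm psi_adm opts.1.
have ALs c : 0 < c -> L c xs (ls, ms) = fs.
  by move=> c0; rewrite fsE; exact: (al_value_KKT ipX_norm ipH_norm phi_adm psi_adm (w := (ls, ms)) c0 KKTs).
pose mK := (m%:R + 1) * K.
have mK0 : 0 <= mK by rewrite mulr_ge0 // addr_ge0.
(* On the sublevel set c k n^2 + |S|^2 / 2 <= fs - f x + C / c, which is at most [K1] since f x >=
   -K and c >= 1. *)
pose K1 := fs + K + C.
(* Coercivity gives |v|^2 <= (2 a)^-1 |kkt_op v|^2; t <= (t + 1)^2 avoids a square root. *)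
pose MQ := (2 * a)^-1 + 1.
have a20 : 0 < (2 * a)^-1 by rewrite invr_gt0 mulr_gt0.
have MQ0 : 0 < MQ by rewrite addr_gt0.
(* Multipliers are bounded through kkt_op w = S - A grad f: here |S| <= 2 |K1| + 1, and [mK * K]
   bounds A grad f. *)
pose Lw := MQ * (2 * `|K1| + 1 + mK * K).
have Lw0 : 0 <= Lw by rewrite mulr_ge0 ?(ltW MQ0) // addr_ge0 ?mulr_ge0 // addr_ge0 // mulr_ge0.
have QM x : Or x -> forall v, nrm v <= MQ * nrm (kkt_op ipX ipH F g x v).
  move=> Ox v; rewrite -(@ler_pXn2r _ 2) ?nnegrE ?mulr_ge0 ?fnorm_ge0 ?(ltW MQ0) //.
  have := hQ x Ox v.1 v.2; rewrite (QformE _ _ _ ipH_norm) exprMn !(sqr_fnorm hpd).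
  have -> : `|v.1| ^+ 2 + enorm v.2 ^+ 2 = mult_dot ipH v v by rewrite /mult_dot ipH_norm sqr_enorm.
  rewrite -ler_pdivlMl // => /le_trans; apply.
  rewrite mulrA -invfM [a * 2]mulrC; apply: ler_wpM2r; first exact: (hf_ge0 hpd).
  by move: a20; rewrite /MQ; move: (2 * a)^-1 => t t0; nra.
(* The thresholds yield membership in [Or]: c k >= r lets the penalty dominate that of [Omega_r],
   and the loss C / c fits into eps. *)
have sub c x w : 1 <= c -> r / k <= c -> C / eps <= c -> Om x -> L c x w <= fs ->
    [/\ Or x, c * nrm (infeasibility F g psi c x w) ^+ 2 <= `|K1| / k, nrm w <= Lw & - K - C <= L c x w].
  move=> c1 rc Cc Ox Lfs.
  have c0 : 0 < c by exact: lt_le_trans c1.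
  have low := lowL c x w c0 Ox; rewrite -/nrm -/(L c x w) in low.
  set n2 := nrm (infeasibility F g psi c x w) ^+ 2 in low *.
  set S2 := nrm _ ^+ 2 in low.
  have n20 : 0 <= n2 by exact: sqr_ge0.
  have S20 : 0 <= S2 by exact: sqr_ge0.
  have Ce : C / c <= eps by rewrite ler_pdivrMr // mulrC -ler_pdivrMr.
  have C1' : C / c <= C by rewrite ler_pdivrMr // ler_peMr // ltW.
  have rk : r <= c * k by rewrite -ler_pdivrMr.
  have ckn : 0 <= c * k * n2 by apply: mulr_ge0 => //; apply: mulr_ge0; exact: ltW.
  have Orx : Or x.
    split=> //; rewrite -/fs.
    have h1 : `|F x| ^+ 2 + enorm (vmax (gvec g x) 0) ^+ 2 <= n2.
      by rewrite /n2 (sqr_norm_infeasibility _ _ _ ipH_norm) lerD2l vmax_le_qvec.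
    have h2 : r * (`|F x| ^+ 2 + enorm (vmax (gvec g x) 0) ^+ 2) <= c * k * n2.
      by apply: ler_pM => //; [exact: ltW|rewrite addr_ge0 // sqr_ge0].
    by move: low Lfs Ce h2 S20; lra.
  have bd := dataK x Orx.
  have fK : - K <= f x by have := jet_val (bd_f bd); rewrite ler_norml => /andP[].
  have nK : c * k * n2 <= K1 by rewrite /K1; move: low Lfs C1' S20 fK; lra.
  have SK : S2 <= 2 * K1 by rewrite /K1; move: low Lfs C1' ckn fK; lra.
  have K1p : K1 <= `|K1| by exact: ler_norm.
  split=> //; last by move: low C1' ckn S20 fK; lra.
    by rewrite ler_pdivlMr // mulrAC; exact: le_trans K1p.
  apply: (le_trans (QM x Orx w)); rewrite /Lw ler_wpM2l ?(ltW MQ0) //.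
  have -> : kkt_op ipX ipH F g x w = kkt_residual ipX ipH f F g x w - constraint_map ipX F g x (grad ipX f x).
    rewrite /kkt_residual /kkt_op (lagr_grad_decomp ipX_norm ipH_norm fD FD gD).
    rewrite (constraint_mapD F ipX_norm gD x _ (constraint_adj ipX ipH F g x w)).
    by rewrite -(addrA (constraint_map ipX F g x (grad ipX f x))) [X in _ = X - _]addrC addrK.
  apply: (le_trans (fnormB hpd _ _)); apply: lerD.
    rewrite -(@ler_pXn2r _ 2) ?nnegrE ?fnorm_ge0 ?addr_ge0 ?mulr_ge0 // -/S2.
    apply: (le_trans SK); have : 0 <= `|K1| ^+ 2 by exact: sqr_ge0.
    by rewrite sqrrD exprMn expr1n mulr1 mulr2n; move: K1p (normr_ge0 K1); lra.
  apply: (le_trans (constraint_map_bound ipX_norm ipH_norm gD _ bd)); rewrite -/mK ler_wpM2l //.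
  apply: (norm_le_dual ipX_norm K0) => h; rewrite gradE //.
  exact: le_trans (ler_norm _) (jet_diff (bd_f bd) _).
have [CS CS0 hCS] := kkt_residual_lipschitz ipX_norm ipH_norm fD FD gD K0 Lw0.
pose D := `|dpsi 0| + 1.
have D0 : 0 <= D by rewrite addr_ge0.
pose bL := (m%:R * D + 1) * (K + 1).
have bL0 : 0 <= bL by rewrite mulr_ge0 // addr_ge0 // mulr_ge0.
pose Kk := `|K1| / k.
have Kk0 : 0 <= Kk by rewrite divr_ge0 // ltW.
(* All bounds merge into one constant, the sum of the list, fixed before c. *)
pose consts := [:: 1; mK; 2 / psi 0; psi 0; Lw; 2 / dphi 0; dphi 0 + 1; bL; CS; MQ; Kk].
pose M := \sum_(t <- consts) t.
have p2 : 0 < 2 / psi 0 by rewrite divr_gt0.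
have s2 : 0 < 2 / dphi 0 by rewrite divr_gt0.
have leM t : t \in consts -> t <= M.
  apply: ler_sum_mem; rewrite /= ler01 mK0 (ltW p2) (ltW psi0) Lw0 (ltW s2) bL0 (ltW CS0).
  by rewrite (ltW MQ0) Kk0 addr_ge0 // ltW.
have M1 : 1 <= M by apply: leM; rewrite mem_head.
have [Cs Cs0 hres] := stationary_residual psi ipX_norm ipH_norm fD FD gD phi_adm M1.
(* Since n^2 <= Kk / c, the last two bring |F|^2 below [d1] and the positive part of g below [d2],
   where the local bounds on phi and psi hold. *)
pose thresholds := [:: 1; r / k; C / eps; Cs; Kk / d1; Kk / d2 ^+ 2].
pose c0 := \sum_(t <- thresholds) t.
have lec0 t : t \in thresholds -> t <= c0.
  apply: ler_sum_mem; rewrite /= ler01 (ltW (divr_gt0 r_gt0 k0)) (ltW (divr_gt0 C0 eps_gt0)).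
  by rewrite (ltW Cs0) !divr_ge0 ?exprn_ge0 // ltW.
exists c0; first by apply: (@lt_le_trans _ _ 1) => //; apply: lec0; rewrite mem_head.
move=> c cc0.
have lec t : t \in thresholds -> t <= c by move=> /lec0 tc0; exact: le_trans cc0.
have c1 : 1 <= c by apply: lec; rewrite mem_head.
have crk : r / k <= c by apply: lec; rewrite !inE eqxx ?orbT.
have cCe : C / eps <= c by apply: lec; rewrite !inE eqxx ?orbT.
have cCs : Cs <= c by apply: lec; rewrite !inE eqxx ?orbT.
have cd1 : Kk / d1 <= c by apply: lec; rewrite !inE eqxx ?orbT.
have cd2 : Kk / d2 ^+ 2 <= c by apply: lec; rewrite !inE eqxx ?orbT.
have cp : 0 < c by exact: lt_le_trans c1.
have crit x w : Om x -> L c x w <= fs -> (forall y w', Om y -> L c x w <= L c y w') ->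
    KKT_point ipX ipH f F g x w.1 w.2 /\ globally_optimal f F g x.
  move=> Ox Lfs hmin; have [Orx cn wL _] := sub c x w c1 crk cCe Ox Lfs.
  have bd := dataK x Orx.
  set n := nrm (infeasibility F g psi c x w) in cn.
  have n0 : 0 <= n by exact: fnorm_ge0.
  have n2 : n ^+ 2 <= Kk / c by rewrite ler_pdivlMr // mulrC.
  have n2d1 : n ^+ 2 <= d1.
    by apply: (le_trans n2); rewrite ler_pdivrMr // mulrC -ler_pdivrMr.
  have nd2 : n <= d2.
    rewrite -(@ler_pXn2r _ 2) ?nnegrE ?(ltW d20) //.
    by apply: (le_trans n2); rewrite ler_pdivrMr // mulrC -ler_pdivrMr // exprn_gt0.
  have nE : n ^+ 2 = `|F x| ^+ 2 + enorm (qvec g psi x w.2 c) ^+ 2.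
    exact: sqr_norm_infeasibility.
  have dom : edom phi (`|F x| ^+ 2) by exact: (Omega_edom (g := g) (psi := psi)).
  have [phiU dphiL] : fine (phi (`|F x| ^+ 2)) <= (dphi 0 + 1) * `|F x| ^+ 2 /\
      dphi 0 / 2 <= dphi (`|F x| ^+ 2).
    by apply: hd1 => //; apply: le_trans n2d1; rewrite nE lerDl sqr_ge0.
  pose Y := vmax (gvec g x) 0.
  have Yn : `|Y| <= d2.
    apply: le_trans nd2; apply: norm_le_coord => // i; apply: (le_trans (le_enorm Y i)).
    rewrite -(@ler_pXn2r _ 2) ?nnegrE ?sqrtr_ge0 // nE.
    by apply: (@le_trans _ _ (enorm (qvec g psi x w.2 c) ^+ 2)); [exact: vmax_le_qvec|rewrite lerDr sqr_ge0].
  have [bl dY] := hd2 Y (vmax0_orthant _) Yn; rewrite -/D in dY.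
  have bpsi : bfun g psi x <= psi 0 by apply: (psi_max0 psi_adm); exact: vmax0_orthant.
  have b0 : 0 < bfun g psi x by case: Ox.
  have lip (B : R) (V : X -> R) : B <= M ->
      (\forall y \near x, V y <= B * `|y - x|) -> \forall y \near x, V y <= M * `|y - x|.
    by move=> BM; apply: filterS => y /le_trans; apply; rewrite ler_wpM2r.
  have [FQ0 L0] : infeasibility F g psi c x w = 0 /\ lagr_grad ipX ipH f F g x w = 0.
    apply: (hres c x w K (dphi (`|F x| ^+ 2))) => //.
    - move=> h; apply: (le_trans (constraint_map_bound ipX_norm ipH_norm gD h bd)).
      by rewrite -/mK ler_wpM2r //; apply: leM; rewrite !inE eqxx ?orbT.
    - apply: (@le_trans _ _ (2 / psi 0)).
        by rewrite -[2 / _]invf_div lef_pV2 ?posrE ?divr_gt0.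
      by apply: leM; rewrite !inE eqxx ?orbT.
    - by apply: (le_trans bpsi); apply: leM; rewrite !inE eqxx ?orbT.
    - by apply: (le_trans wL); apply: leM; rewrite !inE eqxx ?orbT.
    - apply: le_trans dphiL; rewrite -[leRHS]invrK invf_div lef_pV2 ?posrE //.
        by apply: leM; rewrite !inE eqxx ?orbT.
      exact: lt_le_trans M1.
    - exact: hdphi.
    - apply: (le_trans phiU); rewrite ler_wpM2r ?sqr_ge0 //.
      by apply: leM; rewrite !inE eqxx ?orbT.
    - apply: (lip bL); first by apply: leM; rewrite !inE eqxx ?orbT.
      apply: (bfun_lipschitz gD K0 D0 (hdpsi _ (vmax0_orthant _)) dY).
      by move=> i h; exact: jet_diff (bd_g bd i) h.
    - apply: (lip CS); first by apply: leM; rewrite !inE eqxx ?orbT.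
      exact: hCS.
    - move=> v; apply: (le_trans (QM x Orx v)); rewrite ler_wpM2r ?fnorm_ge0 //.
      by apply: leM; rewrite !inE eqxx ?orbT.
    - apply: (le_trans cn); apply: (@le_trans _ _ M).
        by apply: leM; rewrite !inE eqxx ?orbT.
      by rewrite expr2 ler_peMr // (le_trans ler01).
  have hK := KKT_of_residual cp b0 FQ0 L0; split=> //.
  split; first exact: KKT_feasible hK.
  have Lf : L c x w = f x by exact: al_value_KKT.
  by move=> y /opts.2; apply: le_trans; rewrite -fsE -Lf.
have [B hB] := bounded_set_ex level_bounded.
have [xm [wm [Om_m Lm_fs Lm_min]]] : exists x w, [/\ Om x, L c x w <= fs &
    forall y w', Om y -> L c x w <= L c y w'].
  apply: (exists_minimiser ipX_norm ipH_norm phi_adm (B := Num.max B Lw) (lo := - K - C) (AL_wlsc c cp)).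
    by exists xs, (ls, ms); split=> //; rewrite -/(L _ _ _) ALs.
  move=> x w Ox Lx; have [Orx _ wL lo] := sub c x w c1 crk cCe Ox Lx.
  by split=> //; rewrite le_max ?hB ?wL ?orbT.
(* A minimiser is feasible with value [f xm], so no value falls below [fs]. The converse implication
   rests on this, hence on the existence of a minimiser. *)
have min_fs : fs <= L c xm wm.
  have [hK [feas _]] := crit xm wm Om_m Lm_fs Lm_min.
  have -> : L c xm wm = f xm by exact: al_value_KKT.
  by rewrite fsE; exact: opts.2.
have augE x w : Om x -> aug_lagrangian ipX ipH f F g phi psi x w.1 w.2 c = (L c x w)%:E.
  by move=> Ox; exact: aug_lagrangianE.
move=> x lam mu; split.
  move=> gm; have := gm xs ls ms.
  rewrite (augE xs (ls, ms) Os) ALs // => le_fs.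
  have Ox : Om x.
    by move: le_fs; rewrite /aug_lagrangian; case: ifPn => [/set_mem//|_]; rewrite leye_eq.
  rewrite (augE x (lam, mu) Ox) lee_fin in le_fs.
  have [|hK ho] := crit x (lam, mu) Ox le_fs; last by split.
  move=> y w' Oy; have := gm y w'.1 w'.2.
  by rewrite (augE x (lam, mu) Ox) (augE y w' Oy) lee_fin.
move=> [ho hK] y lam' mu'.
have Ox : Om x := feasible_Omega phi_adm psi_adm ho.1.
have Lx : L c x (lam, mu) = fs.
  rewrite /fs (optimal_valueE ho).
  exact: (al_value_KKT ipX_norm ipH_norm phi_adm psi_adm (w := (lam, mu)) cp hK).
rewrite (augE x (lam, mu) Ox) Lx.
have [Oy|nOy] := pselect (Om y); last first.
  by rewrite /aug_lagrangian memNset // leey.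
rewrite (augE y (lam', mu') Oy) lee_fin; apply: (le_trans min_fs); exact: Lm_min.
Qed.
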